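(* Let $n\ge4$. The space $\bar F_n$ is a smooth toric variety for the $(\mathbb{C}^* )^{n-3}$-action $\mathbf{t}\cdot((c_{ij}:c'_{ij}))=((\rho_{ij}(\mathbf{t})c_{ij}:c'_{ij}))$, and its principal orbit contains the space $F_n\cong\mathcal{M}_{0,n}$.
   Context: Let $N=\binom{n-2}{2}$ and $$\bar F_n=\{((c_{ij}:c'_{ij}))_{3\le i<j\le n}\in(\mathbb{C}P^1)^N : c_{ij}c'_{ik}c_{jk}=c'_{ij}c_{ik}c'_{jk}\ \text{for all } 3\le i<j<k\le n\}.$$ $F_n\subset\bar F_n$ is the subset of points all of whose coordinates $(c_{ij}:c'_{ij})$ are different from $(1:0),(0:1),(1:1)$; it is isomorphic to the moduli space $\mathcal{M}_{0,n}$ of smooth $n$-pointed genus zero curves. For $\mathbf{t}=(t_1,\ldots,t_{n-3})\in(\mathbb{C}^* )^{n-3}$ put $\rho_{3k}(\mathbf{t})=t_{k-3}$ for $4\le k\le n$ and $\rho_{ij}(\mathbf{t})=t_{j-3}/t_{i-3}$ for $4\le i<j\le n$; the action given in the claim preserves $\bar F_n$. A point $\mathbf{c}\in\bar F_n$ is called general if its stabilizer is trivial, and the orbit of such a point is called principal. *)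

(* Defs.v *)
From HB Require Import structures.
From mathcomp Require Import all_boot all_order all_algebra.
From mathcomp Require Import boolp classical_sets reals.
From mathcomp Require Import complex.
From mathcomp Require Import mpoly.
From mathcomp Require Import ring.

Set Implicit Arguments.
Unset Strict Implicit.
Unset Printing Implicit Defensive.
Set Warnings "-notation-overridden,-ambiguous-paths,-notation-incompatible-prefix".

Import GRing.Theory.
Local Open Scope ring_scope.
Local Open Scope classical_set_scope.
Local Open Scope quotient_scope.

(* Varieties over an algebraically closed field K are handled, as in the      *)
(* textbooks of Kempf and Springer, as spaces with functions: a set of points *)
(* with its Zariski-open subsets and, on each open subset, its regular        *)
(* functions.  A function on U is represented by a total function, whose      *)
(* values outside U are irrelevant.                                           *)
Record space (K : closedFieldType) := Space {
  point :> Type;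
  opn : set point -> Prop;
  reg : set point -> (point -> K) -> Prop }.

Section Spaces.
Variable K : closedFieldType.
Implicit Types X Y Z : space K.

(* The space in which the sets {G != 0} are a basis of open sets, and regular *)
(* functions are locally quotients F / G, for (F, G) ranging over frac.       *)
Definition frac_space (T : Type) (frac : (T -> K) -> (T -> K) -> Prop) :
    space K :=
  Space
    (fun U => forall x, U x -> exists F G,
       [/\ frac F G, G x != 0 & forall y, G y != 0 -> U y])
    (fun U f => forall x, U x -> exists F G,
       [/\ frac F G, G x != 0 & forall y, U y -> G y != 0 -> f y = F y / G y]).

Definition subspace X (S : set X) : space K :=
  @Space K {x : X | S x}
    (fun U => exists2 V, opn V & U = (fun x => V (sval x)))
    (fun U f => forall x, U x -> exists V h,
       [/\ opn V, V (sval x), reg V h &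
           forall y, U y -> V (sval y) -> f y = h (sval y)]).

(* h is a finite sum of products of regular functions on U and on V. *)
Definition tensor_fun X Y (U : set X) (V : set Y) (h : X * Y -> K) : Prop :=
  exists (m : nat) (f : 'I_m -> X -> K) (g : 'I_m -> Y -> K),
    [/\ forall k, reg U (f k), forall k, reg V (g k) &
        forall p, h p = \sum_(k < m) f k p.1 * g k p.2].

(* The product of varieties; its topology is finer than the product topology. *)
Definition prod_space X Y : space K :=
  @Space K (X * Y)%type
    (fun W => forall p, W p -> exists U V h,
       [/\ opn U /\ opn V, U p.1 /\ V p.2, tensor_fun U V h, h p != 0 &
           forall q, U q.1 -> V q.2 -> h q != 0 -> W q])
    (fun W phi => forall p, W p -> exists U V h h',
       [/\ opn U /\ opn V, U p.1 /\ V p.2,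
           tensor_fun U V h /\ tensor_fun U V h', h' p != 0 &
           forall q, W q -> U q.1 -> V q.2 -> h' q != 0 ->
             phi q = h q / h' q]).

(* The quotient of X by an equivalence relation E; points are the classes. *)
Definition class_of X (E : X -> X -> Prop) (x : X) :
    {C : set X | exists x, C = E x} :=
  exist _ (E x : set X) (ex_intro _ x erefl).

Definition quotient_space X (E : X -> X -> Prop) : space K :=
  @Space K {C : set X | exists x, C = E x}
    (fun U => opn (class_of E @^-1` U))
    (fun U f => reg (class_of E @^-1` U) (f \o class_of E)).

Definition morphism X Y (f : X -> Y) : Prop :=
  forall V, opn V ->
    opn (f @^-1` V) /\ forall g, reg V g -> reg (f @^-1` V) (g \o f).

Definition isomorphism X Y (f : X -> Y) : Prop :=
  morphism f /\ exists g : Y -> X, [/\ morphism g, cancel f g & cancel g f].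

Definition isomorphic X Y : Prop := exists f : X -> Y, isomorphism f.

Definition open_immersion X Y (f : X -> Y) : Prop :=
  opn (range f) /\
  exists2 g : X -> subspace (range f), isomorphism g &
    forall x, sval (g x) = f x.

Definition irreducible_set X (Z : set X) : Prop :=
  Z !=set0 /\
  forall U V, opn U -> opn V -> Z `&` U !=set0 -> Z `&` V !=set0 ->
    Z `&` (U `&` V) !=set0.

Definition irreducible X : Prop := irreducible_set [set: X].

Definition irreducible_chain X (d : nat) (Z : nat -> set X) : Prop :=
  (forall i, (i <= d)%N -> opn (~` Z i) /\ irreducible_set (Z i)) /\
  (forall i, (i < d)%N -> Z i `<` Z i.+1).

Definition dimension X (d : nat) : Prop :=
  (exists Z : nat -> set X, irreducible_chain d Z) /\
  (forall m (Z : nat -> set X), irreducible_chain m Z -> (m <= d)%N).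

Definition near_eq X (x : X) (f g : X -> K) : Prop :=
  exists U : set X, [/\ opn U, U x & forall y, U y -> f y = g y].

Definition reg_at X (x : X) (f : X -> K) : Prop :=
  exists U : set X, [/\ opn U, U x & reg U f].

(* The Zariski tangent space at x: K-derivations of the local ring at x with  *)
(* values in the residue field.                                               *)
Definition tangent_vector X (x : X) (D : (X -> K) -> K) : Prop :=
  forall f g, reg_at x f -> reg_at x g ->
    [/\ near_eq x f g -> D f = D g,
        forall a : K, D (fun y => a * f y + g y) = a * D f + D g &
        D (fun y => f y * g y) = f x * D g + D f * g x].

Definition tangent_dimension X (x : X) (d : nat) : Prop :=
  exists b : 'I_d -> (X -> K) -> K,
    (forall i, tangent_vector x (b i)) /\
    (forall D, tangent_vector x D -> exists! a : 'rV[K]_d,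
       forall f, reg_at x f -> D f = \sum_(i < d) a 0 i * b i f).

(* For irreducible X, whose local dimension is constant. *)
Definition smooth X : Prop :=
  exists2 d, dimension X d & forall x : X, tangent_dimension x d.

Definition affine_space (A : finType) : space K :=
  frac_space (fun F G : {ffun A -> K} -> K =>
    exists P Q : {mpoly K[#|A|]},
      (forall t, F t = P.@[fun k => t (enum_val k)]) /\
      (forall t, G t = Q.@[fun k => t (enum_val k)])).

Definition torus (A : finType) : space K :=
  subspace [set t : affine_space A | forall a, t a != 0].

Lemma torus_one_subproof (A : finType) : forall a : A, [ffun=> 1 : K] a != 0.
Proof. by move=> a; rewrite ffunE oner_neq0. Qed.

Definition torus_one (A : finType) : torus A :=
  exist _ [ffun=> 1 : K] (@torus_one_subproof A).

Lemma torus_mul_subproof (A : finType) (s t : torus A) (a : A) :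
  [ffun a => sval s a * sval t a] a != 0.
Proof.
by rewrite ffunE mulf_neq0 //; [apply: (svalP s) | apply: (svalP t)].
Qed.

Definition torus_mul (A : finType) (s t : torus A) : torus A :=
  exist _ [ffun a => sval s a * sval t a] (torus_mul_subproof s t).

Definition algebraic_action (A : finType) X (act : torus A -> X -> X) : Prop :=
  [/\ forall x, act (torus_one A) x = x,
      forall s t x, act (torus_mul s t) x = act s (act t x) &
      morphism (fun p : prod_space (torus A) X => act p.1 p.2)].

Definition hcoord : Type := {v : K * K | v != (0, 0)}.

Definition proportional (v w : hcoord) : bool :=
  (val v).1 * (val w).2 == (val v).2 * (val w).1.

Lemma proportional_equiv : equiv_class_of proportional.
Proof.
split=> [v|v w|w u v]; rewrite /proportional; first by rewrite mulrC.
  by rewrite eq_sym mulrC [X in _ == X]mulrC.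
case: w => -[w1 w2] /= nzw /eqP uw /eqP wv; apply/eqP.
case: (eqVneq w1 0) => [w10|nz1].
  have nz2: w2 != 0 by apply: contraNneq nzw => ->; rewrite w10.
  apply: (mulfI nz2); move: uw wv; rewrite w10 !mulr0 mul0r => uw wv.
  have /eqP := uw; rewrite mulf_eq0 (negPf nz2) orbF => /eqP ->.
  have /eqP := esym wv; rewrite mulf_eq0 (negPf nz2) /= => /eqP ->.
  by rewrite mul0r !mulr0.
apply: (mulfI nz1).
have -> : w1 * ((val u).1 * (val v).2) = (val u).1 * (w1 * (val v).2) by ring.
by rewrite wv mulrA uw; ring.
Qed.

Canonical proportional_equiv_rel := EquivRelPack proportional_equiv.

Definition P1 : Type := {eq_quot proportional}.

(* Homogeneous coordinates (c : c') of a point: hc x is the pair (c, c') of a *)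
(* chosen representative, and hpt c c' is the point (c : c') (an arbitrary    *)
(* point if c = c' = 0).                                                      *)
Definition hc (x : P1) : K * K := val (repr (x : {eq_quot proportional})).

Lemma hpt_subproof : ((1, 1) : K * K) != (0, 0).
Proof. by rewrite xpair_eqE oner_eq0. Qed.

Definition hpt (c c' : K) : P1 :=
  \pi_{eq_quot proportional}
    (insubd (exist (fun v => v != (0, 0)) (1, 1) hpt_subproof : hcoord) (c, c')).

End Spaces.

Arguments torus_one {K} A.
Arguments hpt {K} c c'.

Section Multiprojective.
Variables (K : closedFieldType) (I : finType).

(* Polynomials in the homogeneous coordinates of (P^1)^I: the variable        *)
(* (i, false) is c_i and (i, true) is c'_i.                                   *)
Definition multihomogeneous (e : I -> nat) (F : {mpoly K[#|{: I * bool}|]}) :=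
  forall m, m \in msupp F -> forall i,
    (m (enum_rank (i, false)) + m (enum_rank (i, true)))%N = e i.

Definition heval (F : {mpoly K[#|{: I * bool}|]}) (x : {ffun I -> P1 K}) : K :=
  F.@[fun k => let: (i, b) := enum_val k in
               if b then (hc (x i)).2 else (hc (x i)).1].

Definition P1pow : space K :=
  frac_space (fun F G : {ffun I -> P1 K} -> K =>
    exists (e : I -> nat) (P Q : {mpoly K[#|{: I * bool}|]}),
      [/\ multihomogeneous e P, multihomogeneous e Q,
          F = heval P & G = heval Q]).

(* The closed subset S of (P^1)^I is a smooth toric variety under the action  *)
(* act of (K^* )^A.  A smooth variety is normal, so that normality need not   *)
(* be required; the orbit in the last clause is dense, S being irreducible.   *)
Definition smooth_toric_variety (A : finType) (S : set P1pow)
    (act : torus K A -> subspace S -> subspace S) : Prop :=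
  [/\ opn (~` S),
      irreducible (subspace S),
      smooth (subspace S),
      algebraic_action act &
      exists x : subspace S, open_immersion (fun t => act t x)].

End Multiprojective.

Section PrincipalOrbits.
Variables (K : closedFieldType) (A : finType) (X : space K).
Variable act : torus K A -> X -> X.

Definition orbit (x : X) : set X := range (fun t => act t x).

Definition general (x : X) : Prop := forall t, act t x = x -> t = torus_one A.

Definition principal_orbit (O : set X) : Prop :=
  exists2 x, general x & O = orbit x.

End PrincipalOrbits.

(* The moduli space of n distinct ordered points on P^1: the quotient of      *)
(* their configuration space by PGL_2.                                        *)
Section Moduli.
Variables (K : closedFieldType) (n : nat).

Definition moebius (M : 'M[K]_2) (x : P1 K) : P1 K :=
  hpt (M 0 0 * (hc x).1 + M 0 1 * (hc x).2)
      (M 1 0 * (hc x).1 + M 1 1 * (hc x).2).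

Definition configurations : space K :=
  subspace [set z : P1pow K 'I_n | injective z].

Definition PGL2_equiv (z w : configurations) : Prop :=
  exists2 M : 'M[K]_2, M \in unitmx &
    forall k, sval w k = moebius M (sval z k).

Definition M0 : space K := quotient_space PGL2_equiv.

End Moduli.

Section FBar.
Variables (K : closedFieldType) (n : nat).

Definition pairs : Type :=
  {p : 'I_n.+1 * 'I_n.+1 | (3 <= p.1)%N && (p.1 < p.2)%N}.

(* The pairs p, q, r are (i, j), (i, k), (j, k). *)
Definition Fbar : set (P1pow K pairs) :=
  [set c : {ffun pairs -> P1 K} | forall p q r : pairs,
     (val p).1 = (val q).1 -> (val p).2 = (val r).1 ->
     (val q).2 = (val r).2 ->
     (hc (c p)).1 * (hc (c q)).2 * (hc (c r)).1 =
     (hc (c p)).2 * (hc (c q)).1 * (hc (c r)).2].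

Definition FbarS : space K := subspace Fbar.

Definition Fopen : set FbarS :=
  [set c : FbarS | forall p,
     [/\ sval c p <> hpt 1 0, sval c p <> hpt 0 1 & sval c p <> hpt 1 1]].

(* t_k for 1 <= k <= n - 3; the coordinates of t are numbered from 0. *)
Definition tcoord (t : torus K 'I_(n - 3)) (k : nat) : K :=
  if insub k.-1 is Some o then sval t o else 1.

Definition rho (t : torus K 'I_(n - 3)) (p : pairs) : K :=
  let i : nat := (val p).1 in let j : nat := (val p).2 in
  if i == 3%N then tcoord t (j - 3)%N
  else tcoord t (j - 3)%N / tcoord t (i - 3)%N.

Definition act_P1pow (t : torus K 'I_(n - 3)) (c : P1pow K pairs) :
    P1pow K pairs :=
  [ffun p => hpt (rho t p * (hc (c p)).1) (hc (c p)).2].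

Lemma hc_neq0 (x : P1 K) : hc x != (0, 0).
Proof. exact: (valP (repr (x : {eq_quot @proportional K}))). Qed.

Lemma hc_hpt (a b : K) : (a, b) != (0, 0) ->
  exists2 l : K, l != 0 & hc (hpt a b) = (l * a, l * b).
Proof.
move=> nz; pose v : hcoord K :=
  insubd (exist (fun v => v != (0, 0)) (1, 1) (hpt_subproof K) : hcoord K) (a, b).
have vE : val v = (a, b) by rewrite val_insubd nz.
have : proportional (repr (\pi_{eq_quot @proportional K} v)) v.
  by rewrite -(eqmodE (@proportional_equiv_rel K)) reprK.
rewrite /proportional vE /= -/(hpt a b) -/(hc (hpt a b)).
move: (hc_neq0 (hpt a b)); case: (hc _) => x y /= nzxy /eqP xy.
case: (eqVneq a 0) nz xy => [-> nz|nza nz xy].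
  have nzb : b != 0 by apply: contraNneq nz => ->.
  rewrite mulr0 => /eqP; rewrite mulf_eq0 (negPf nzb) orbF => /eqP x0.
  exists (y / b); last by rewrite x0 mulr0 divfK.
  rewrite mulf_neq0 ?invr_neq0 //.
  by apply: contraNneq nzxy => ->; rewrite x0.
exists (x / a); last by rewrite divfK // mulrAC xy mulfK.
rewrite mulf_neq0 ?invr_neq0 //; apply: contraNneq nzxy => x0.
by move: xy; rewrite x0 mul0r => /esym/eqP; rewrite mulf_eq0 (negPf nza) orbF
  => /eqP ->.
Qed.

Lemma tcoord_neq0 t k : tcoord t k != 0.
Proof.
by rewrite /tcoord; case: insubP => [o _ _|_]; [apply: (svalP t)|apply: oner_neq0].
Qed.

Lemma rho_neq0 t p : rho t p != 0.
Proof.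
by rewrite /rho; case: ifP => _; rewrite ?mulf_neq0 ?invr_neq0 ?tcoord_neq0.
Qed.

Lemma hc_act t c p : exists2 l : K, l != 0 &
  hc ((act_P1pow t c : {ffun pairs -> P1 K}) p) =
  (l * (rho t p * (hc (c p)).1), l * (hc (c p)).2).
Proof.
rewrite ffunE; apply: hc_hpt; rewrite xpair_eqE mulf_eq0 (negPf (rho_neq0 t p)).
by move: (hc_neq0 (c p)); case: (hc _) => a b; rewrite xpair_eqE.
Qed.

Lemma act_Fbar_subproof (t : torus K 'I_(n - 3)) (c : FbarS) :
  Fbar (act_P1pow t (sval c)).
Proof.
case: c => c /= Fc p q r pq pr qr; have eqc := Fc p q r pq pr qr.
have rhoM : rho t q = rho t p * rho t r.
  rewrite /rho -pq -pr -qr.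
  have := valP p; have := valP r; rewrite -pr => /andP[_ _] /andP[ge3 lt_ij].
  rewrite (gtn_eqF (leq_ltn_trans ge3 lt_ij)).
  have nzj := tcoord_neq0 t ((val p).2 - 3)%N.
  have nzi := tcoord_neq0 t ((val p).1 - 3)%N.
  move: nzj nzi; set x := tcoord t _; set y := tcoord t _; set z := tcoord t _.
  by case: (_ == 3%N) => nzj nzi; field; rewrite ?nzj ?nzi.
have [l _ ->] := hc_act t c p; have [l' _ ->] := hc_act t c q.
have [l'' _ ->] := hc_act t c r; rewrite /= rhoM.
transitivity (l * l' * l'' * rho t p * rho t r *
  ((hc (c p)).1 * (hc (c q)).2 * (hc (c r)).1)); first by ring.
by rewrite eqc; ring.
Qed.

Definition act_Fbar (t : torus K 'I_(n - 3)) (c : FbarS) : FbarS :=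
  exist _ (act_P1pow t (sval c)) (act_Fbar_subproof t c).

End FBar.

(* Main.v *)
From mathcomp Require Import all_boot all_order all_algebra.
From mathcomp Require Import boolp classical_sets reals.
From mathcomp Require Import complex.
From mathcomp Require Import mpoly.
From mathcomp Require Import ring zify.
Require Import Defs.

(* Put x_ij = c_ij / c'_ij and x_ji = 1 / x_ij, so that x_ij x_jk = x_ik.  At *)
(* a point of Fbar, "x_ij is finite" is a total preorder on {3, ..., n}; sort *)
(* the indices by it into s_0, ..., s_(n-3).  Near the point the n - 3        *)
(* functions x_(s_k s_(k+1)) are finite, and all other x_ij are products of   *)
(* these or inverses of such products: they are coordinates of an open        *)
(* immersion of A^(n-3).  All these charts contain the point with all x_ij    *)
(* equal to 1, so Fbar is irreducible and smooth of dimension n - 3.          *)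
(*   A chain of d proper inclusions of irreducible closed subsets of A^m      *)
(* gives d polynomials that are algebraically independent on the largest one; *)
(* counting monomials yields d <= m.                                          *)
(*   A point with some x_ij in {0, infinity} is fixed by a nontrivial element *)
(* of the torus; the other points are the orbit of (1 : 1), t being recovered *)
(* as the x_3j.                                                               *)
(*   With z_1 = 0, z_2 = infinity, z_3 = 1 and z_j = x_3j, the x_ij are the   *)
(* cross ratios of z_i, z_j, z_1, z_2, which identifies F with M_(0,n).       *)

Set Implicit Arguments.
Unset Strict Implicit.
Unset Printing Implicit Defensive.

Import GRing.Theory.
Local Open Scope ring_scope.
Local Open Scope classical_set_scope.
Local Open Scope quotient_scope.

(** * Spaces with functions that are sheaves *)

(** A [space] carries no axioms, so [function_sheaf] collects those of a sheaf of functions, and the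
    spaces in play are shown to satisfy them. A map into affine space is then tested on its
    coordinates ([morphism_affine]), and a map into a power of the projective line on local regular
    homogeneous coordinates ([morphism_P1pow]).

    The equations of the variety say that the ratios x_ij = c_ij / c'_ij form a multiplicative
    cocycle, also where some of them are 0 or infinite ([crd_cocycle]). An ordering of the indices
    whose successive ratios are finite turns these ratios into affine coordinates
    ([chart_chart_map]); sorting produces such an ordering at every point ([Fbar_atlas]).
    Irreducibility, dimension and tangent spaces can be read off in charts ([irreducible_atlas],
    [smooth_atlas]), so everything reduces to affine space: its dimension is bounded by counting
    monomials ([dimension_affine_space]), and its tangent vectors are combinations of partial
    derivatives ([tangent_dimension_affine_space]).

    The action multiplies x_ij by w_j / w_i, where w_3 = 1 and the other w_k are free. Hence the
    orbit of the point with all x_ij = 1 is the locus where every x_3k is neither 0 nor infinity. It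
    is open and isomorphic to the torus ([chart_torus]), and a point outside it has a nontrivial
    stabilizer ([general_nondegenerate]), so it is the only principal orbit. On the moduli side,
    [cross_ratio_open] and [normal_form_conf] are morphisms that are inverse to each other modulo
    PGL_2 ([normal_formK], [cross_ratioK]). *)

Section Sheaves.
Variable K : closedFieldType.
Implicit Types X Y Z : space K.

(** Both locality axioms are stated pointwise; [opn_local] yields arbitrary unions and, vacuously,
    the empty set. *)
Record function_sheaf X : Prop := FunctionSheaf {
  opn_setT : opn [set: X];
  opnI : forall U V : set X, opn U -> opn V -> opn (U `&` V);
  opn_local : forall U : set X,
    (forall x, U x -> exists V : set X, [/\ opn V, V x & V `<=` U]) -> opn U;
  reg_local : forall (U : set X) f, (forall x, U x -> exists V g,
    [/\ opn V, V x, reg V g & forall y, U y -> V y -> f y = g y]) -> reg U f;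
  reg_cst : forall (U : set X) a, reg U (fun=> a);
  regD : forall (U : set X) f g,
    reg U f -> reg U g -> reg U (fun x => f x + g x);
  regM : forall (U : set X) f g,
    reg U f -> reg U g -> reg U (fun x => f x * g x);
  regV : forall (U : set X) f,
    reg U f -> (forall x, U x -> f x != 0) -> reg U (fun x => (f x)^-1);
  opn_neq0 : forall (U : set X) f,
    opn U -> reg U f -> opn [set x | U x /\ f x != 0] }.

(** The common shape of [frac_space] and [prod_space]: basic open sets are the D with G != 0, and
    functions are quotients F / G with F and G admissible on D. The closure conditions on [B] are
    those needed for the arithmetic of fractions. *)
Lemma base_sheaf X (B : set X -> (X -> K) -> (X -> K) -> Prop) :
  (forall U : set X, opn U <-> forall x, U x -> exists D F G,
     [/\ B D F G, D x, G x != 0 & forall y, D y -> G y != 0 -> U y]) ->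
  (forall (U : set X) f, reg U f <-> forall x, U x -> exists D F G,
     [/\ B D F G, D x, G x != 0 &
         forall y, U y -> D y -> G y != 0 -> f y = F y / G y]) ->
  (forall a, B setT (fun=> a) (fun=> 1)) ->
  (forall D F G, B D F G -> B D G F) ->
  (forall D F G, B D F G -> B D G G) ->
  (forall D F G D' F' G', B D F G -> B D' F' G' ->
     B (D `&` D') (fun x => F x * F' x) (fun x => G x * G' x)) ->
  (forall D F G D' F' G', B D F G -> B D' F' G' ->
     B (D `&` D') (fun x => F x * G' x + F' x * G x) (fun x => G x * G' x)) ->
  function_sheaf X.
Proof.
move=> opnE regE B1 BC BR BM BD; split.
- apply/opnE => x _; exists setT, (fun=> 1), (fun=> 1).
  by split=> //; exact: oner_neq0.
- move=> U V /opnE oU /opnE oV; apply/opnE => x [Ux Vx].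
  have [D [F [G [b Dx Gx DU]]]] := oU x Ux.
  have [D' [F' [G' [b' Dx' Gx' DV]]]] := oV x Vx.
  exists (D `&` D'), (fun x => F x * F' x), (fun x => G x * G' x).
  split; [exact: BM| by []| by rewrite mulf_neq0|] => y [Dy Dy'].
  by rewrite mulf_eq0 negb_or => /andP[? ?]; split; [apply: DU|apply: DV].
- move=> U oU; apply/opnE => x Ux.
  have [V [/opnE oV Vx VU]] := oU x Ux.
  have [D [F [G [b Dx Gx DV]]]] := oV x Vx.
  by exists D, F, G; split=> // y Dy Gy; apply/VU/DV.
- move=> U f rU; apply/regE => x Ux.
  have [V [g [/opnE oV Vx /regE rg fg]]] := rU x Ux.
  have [D [F [G [b Dx Gx DV]]]] := oV x Vx.
  have [D' [F' [G' [b' Dx' Gx' gE]]]] := rg x Vx.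
  (* The fraction for [g] is expanded by [G], so that its denominator vanishes outside [V], where f
     = g is unknown. *)
  exists (D `&` D'), (fun x => G x * F' x), (fun x => G x * G' x).
  split; [exact: (BM _ _ _ _ _ _ (BR _ _ _ b) b')| by []| |].
    by rewrite mulf_neq0.
  move=> y Uy [Dy Dy']; rewrite mulf_eq0 negb_or => /andP[Gy Gy'].
  have Vy := DV y Dy Gy; rewrite fg // gE // -mulf_div divff // mul1r //.
- move=> U a; apply/regE => x Ux; exists setT, (fun=> a), (fun=> 1).
  by split=> // [|y _ _ _]; rewrite ?oner_neq0 // divr1.
- move=> U f g /regE rf /regE rg; apply/regE => x Ux.
  have [D [F [G [b Dx Gx fE]]]] := rf x Ux.
  have [D' [F' [G' [b' Dx' Gx' gE]]]] := rg x Ux.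
  exists (D `&` D'), (fun x => F x * G' x + F' x * G x), (fun x => G x * G' x).
  split; [exact: BD| by []| by rewrite mulf_neq0|] => y Uy [Dy Dy'].
  by rewrite mulf_eq0 negb_or => /andP[? ?]; rewrite fE // gE // addf_div.
- move=> U f g /regE rf /regE rg; apply/regE => x Ux.
  have [D [F [G [b Dx Gx fE]]]] := rf x Ux.
  have [D' [F' [G' [b' Dx' Gx' gE]]]] := rg x Ux.
  exists (D `&` D'), (fun x => F x * F' x), (fun x => G x * G' x).
  split; [exact: BM| by []| by rewrite mulf_neq0|] => y Uy [Dy Dy'].
  by rewrite mulf_eq0 negb_or => /andP[? ?]; rewrite -mulf_div fE // gE.
- move=> U f /regE rf fN0; apply/regE => x Ux.
  have [D [F [G [b Dx Gx fE]]]] := rf x Ux.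
  have := fN0 x Ux; rewrite fE // mulf_eq0 invr_eq0 negb_or => /andP[Fx _].
  (* The inverse G / F is expanded by [G], so that the old formula for [f] holds wherever the new
     denominator is nonzero. *)
  exists (D `&` D), (fun x => G x * G x), (fun x => F x * G x).
  split; [exact: (BM _ _ _ _ _ _ (BC _ _ _ b) (BR _ _ _ b))| by []| by rewrite mulf_neq0|] => y Uy [Dy _].
  rewrite mulf_eq0 negb_or => /andP[Fy Gy].
  by rewrite fE // -mulf_div divff // mulr1 invf_div.
- move=> U f /opnE oU /regE rf; apply/opnE => x [Ux fx].
  have [D [F [G [b Dx Gx fE]]]] := rf x Ux.
  have [D' [F' [G' [b' Dx' Gx' gE]]]] := oU x Ux.
  have Fx : F x != 0 by apply: contraNneq fx => F0; rewrite fE // F0 mul0r.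
  exists (D `&` D `&` D'), (fun x => F x * G x * F' x),
    (fun x => G x * F x * G' x).
  split; [exact: (BM _ _ _ _ _ _ (BM _ _ _ _ _ _ b (BC _ _ _ b)) b')| by []| by rewrite !mulf_neq0|].
  move=> y [[Dy _] Dy']; rewrite !mulf_eq0 !negb_or => /andP[/andP[Gy Fy] Gy'].
  by have Uy := gE y Dy' Gy'; split=> //; rewrite fE // mulf_neq0 ?invr_eq0.
Qed.

Lemma frac_space_sheaf T (frac : (T -> K) -> (T -> K) -> Prop) :
  (forall a, frac (fun=> a) (fun=> 1)) ->
  (forall F G, frac F G -> frac G F) ->
  (forall F G, frac F G -> frac G G) ->
  (forall F G F' G', frac F G -> frac F' G' ->
     frac (fun x => F x * F' x) (fun x => G x * G' x)) ->
  (forall F G F' G', frac F G -> frac F' G' ->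
     frac (fun x => F x * G' x + F' x * G x) (fun x => G x * G' x)) ->
  function_sheaf (frac_space frac).
Proof.
move=> f1 fC fR fM fD.
apply: (@base_sheaf (frac_space frac) (fun D F G => D = setT /\ frac F G)).
- move=> U; split=> oU x /oU.
    by move=> [F [G [fr Gx GU]]]; exists setT, F, G; split=> // y _; apply: GU.
  by move=> [_ [F [G [[-> fr] _ Gx GU]]]]; exists F, G; split=> // y; apply: GU.
- move=> U f; split=> rf x /rf.
    by move=> [F [G [fr Gx GU]]]; exists setT, F, G; split=> // y Uy _; apply: GU.
  move=> [_ [F [G [[-> fr] _ Gx GU]]]]; exists F, G.
  by split=> // y Uy; apply: GU.
- by [].
- by move=> D F G [-> fr]; split=> //; apply: fC.
- by move=> D F G [-> fr]; split=> //; apply: fR fr.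
- by move=> D F G D' F' G' [-> ?] [-> ?]; rewrite setIT; split=> //; apply: fM.
- by move=> D F G D' F' G' [-> ?] [-> ?]; rewrite setIT; split=> //; apply: fD.
Qed.

Section SheafTheory.
Variables (X : space K) (shX : function_sheaf X).

Lemma opn_bigI (I : finType) (U : I -> set X) (x : X) :
  (forall i, opn (U i) /\ U i x) ->
  exists V : set X, [/\ opn V, V x & forall i, V `<=` U i].
Proof.
move=> oU; suff [V [oV Vx VU]] : exists V : set X,
    [/\ opn V, V x & forall i, i \in enum I -> V `<=` U i].
  by exists V; split=> // i; apply: VU; rewrite mem_enum.
elim: (enum I) => [|i s [V [oV Vx VU]]].
  by exists setT; split=> //; exact: opn_setT.
have [oi Ui] := oU i; exists (U i `&` V); split=> //; first exact: opnI.
move=> j; rewrite inE => /orP[/eqP->|js] y [? ?] //; exact: (VU j).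
Qed.

Lemma reg_ext (U : set X) f g : g =1 f -> reg U f -> reg U g.
Proof. by move=> /funext ->. Qed.

Lemma reg_sub (U V : set X) f : opn U -> reg U f -> V `<=` U -> reg V f.
Proof.
by move=> oU rf VU; apply: (reg_local shX) => x /VU Ux; exists U, f.
Qed.

Lemma regN (U : set X) f : reg U f -> reg U (fun x => - f x).
Proof.
move=> rf; apply: (reg_ext (fun x => esym (mulN1r (f x)))).
by apply: regM => //; apply: reg_cst.
Qed.

Lemma reg_prod (I : Type) (r : seq I) (P : pred I) (U : set X) (f : I -> X -> K) :
  (forall i, P i -> reg U (f i)) -> reg U (fun x => \prod_(i <- r | P i) f i x).
Proof.
move=> rf; elim: r => [|i r IHr].
  by apply: reg_ext (reg_cst shX U _) => x; rewrite big_nil.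
case Pi: (P i); last by apply: reg_ext IHr => x; rewrite big_cons Pi.
by apply: reg_ext (regM shX (rf i Pi) IHr) => x; rewrite big_cons Pi.
Qed.

Lemma reg_sum (I : Type) (r : seq I) (P : pred I) (U : set X) (f : I -> X -> K) :
  (forall i, P i -> reg U (f i)) -> reg U (fun x => \sum_(i <- r | P i) f i x).
Proof.
move=> rf; elim: r => [|i r IHr].
  by apply: reg_ext (reg_cst shX U _) => x; rewrite big_nil.
case Pi: (P i); last by apply: reg_ext IHr => x; rewrite big_cons Pi.
by apply: reg_ext (regD shX (rf i Pi) IHr) => x; rewrite big_cons Pi.
Qed.

Lemma regX (U : set X) f k : reg U f -> reg U (fun x => f x ^+ k).
Proof.
move=> rf; elim: k => [|k IHk]; first exact: reg_cst.
by apply: reg_ext (regM shX rf IHk) => x; rewrite exprS.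
Qed.

Lemma reg_meval k (P : {mpoly K[k]}) (U : set X) (f : 'I_k -> X -> K) :
  (forall i, reg U (f i)) -> reg U (fun x => P.@[fun i => f i x]).
Proof.
move=> rf; apply: reg_ext => [x|]; first by rewrite mevalE.
apply: reg_sum => m _; apply: regM => //; first exact: reg_cst.
by apply: reg_prod => i _; apply: regX.
Qed.

Lemma subspace_sheaf (S : set X) : function_sheaf (subspace S).
Proof.
split.
- by exists setT => //; exact: opn_setT.
- move=> _ _ [U oU ->] [V oV ->].
  by exists (U `&` V) => //; exact: opnI.
- move=> U oU.
  (* A locally open set is the trace of the union of all ambient open sets whose trace it
     contains. *)
  exists [set y | exists W : set X, (opn W /\ (forall x, W (sval x) -> U x)) /\ W y].
    apply: opn_local => // y [W [[oW WU] Wy]].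
    by exists W; split=> // z Wz; exists W.
  apply/seteqP; split=> x.
    by move=> /oU[_ [[W oW ->] Wx WU]]; exists W.
  by move=> [W [[_ WU] /WU]].
- move=> U f rf x /rf[_ [g [[W oW ->] Wx rg fg]]].
  have [V [h [oV Vx rh gh]]] := rg x Wx.
  exists (V `&` W), h; split=> //; first exact: opnI.
    by apply: (reg_sub oV rh) => y [].
  by move=> y Uy [Vy Wy]; rewrite fg // gh.
- move=> U a x Ux; exists setT, (fun=> a); split=> //; first exact: opn_setT.
  exact: reg_cst.
- move=> U f g rf rg x Ux.
  have [V [h [oV Vx rh fh]]] := rf x Ux; have [V' [h' [oV' Vx' rh' gh']]] := rg x Ux.
  exists (V `&` V'), (fun x => h x + h' x); split=> //; first exact: opnI.
    apply: regD => //; [apply: (reg_sub oV rh)|apply: (reg_sub oV' rh')];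
    by move=> y [].
  by move=> y Uy [Vy Vy']; rewrite fh // gh'.
- move=> U f g rf rg x Ux.
  have [V [h [oV Vx rh fh]]] := rf x Ux; have [V' [h' [oV' Vx' rh' gh']]] := rg x Ux.
  exists (V `&` V'), (fun x => h x * h' x); split=> //; first exact: opnI.
    apply: regM => //; [apply: (reg_sub oV rh)|apply: (reg_sub oV' rh')];
    by move=> y [].
  by move=> y Uy [Vy Vy']; rewrite fh // gh'.
- move=> U f rf fN0 x Ux; have [V [h [oV Vx rh fh]]] := rf x Ux.
  exists [set x | V x /\ h x != 0], (fun x => (h x)^-1); split=> //.
  + exact: opn_neq0.
  + by split=> //; rewrite -fh // fN0.
  + by apply: regV => // [|y []//]; apply: (reg_sub oV rh) => y [].
  + by move=> y Uy [Vy _]; rewrite fh.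
- move=> _ f [U oU ->] rf.
  exists [set y | exists W : set X, (opn W /\
    (forall x : {x | S x}, W (sval x) -> U (sval x) /\ f x != 0)) /\ W y].
    apply: opn_local => // y [W [[oW WU] Wy]].
    by exists W; split=> // z Wz; exists W.
  apply/seteqP; split=> x; last by move=> [W [[_ WU] /WU]].
  move=> [Ux fx]; have [V [h [oV Vx rh fh]]] := rf x Ux.
  exists [set x | (V `&` U) x /\ h x != 0]; split; last by rewrite /= -fh.
  split; last by move=> y /= [[Vy Uy]]; rewrite -fh.
  apply: opn_neq0 => //; first exact: opnI.
  by apply: (reg_sub oV rh) => y [].
Qed.

End SheafTheory.

(** * Products and morphisms of spaces with functions *)

Lemma tensor_fun_sub X Y (U U' : set X) (V V' : set Y) h :
  function_sheaf X -> function_sheaf Y -> opn U -> opn V ->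
  U' `<=` U -> V' `<=` V -> tensor_fun U V h -> tensor_fun U' V' h.
Proof.
move=> shX shY oU oV UU VV [m [f [g [rf rg hE]]]]; exists m, f, g.
by split=> // k; [apply: (reg_sub shX oU)|apply: (reg_sub shY oV)].
Qed.

Lemma tensor_funD X Y (U : set X) (V : set Y) h h' :
  tensor_fun U V h -> tensor_fun U V h' ->
  tensor_fun U V (fun p => h p + h' p).
Proof.
move=> [m [f [g [rf rg hE]]]] [m' [f' [g' [rf' rg' hE']]]].
exists (m + m')%N, (fun k => match split k with inl i => f i | inr i => f' i end),
  (fun k => match split k with inl i => g i | inr i => g' i end).
split=> [k|k|p]; [by case: split|by case: split|].
rewrite hE hE' big_split_ord /=; congr (_ + _); apply: eq_bigr => i _.
  by rewrite -[lshift _ _]/(unsplit (inl i)) unsplitK.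
by rewrite -[rshift _ _]/(unsplit (inr i)) unsplitK.
Qed.

Lemma tensor_fun_pure X Y (U : set X) (V : set Y) f g :
  reg U f -> reg V g -> tensor_fun U V (fun p => f p.1 * g p.2).
Proof.
move=> rf rg; exists 1%N, (fun=> f), (fun=> g).
by split=> // p; rewrite big_ord1.
Qed.

Lemma tensor_funM X Y (U : set X) (V : set Y) h h' :
  function_sheaf X -> function_sheaf Y ->
  tensor_fun U V h -> tensor_fun U V h' ->
  tensor_fun U V (fun p => h p * h' p).
Proof.
move=> shX shY [m [f [g [rf rg hE]]]] [m' [f' [g' [rf' rg' hE']]]].
exists #|{: 'I_m * 'I_m'}|,
  (fun k => let: (i, j) := enum_val k in fun x => f i x * f' j x),
  (fun k => let: (i, j) := enum_val k in fun x => g i x * g' j x).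
split=> [k|k|p]; [by case: enum_val => i j; apply: regM..|].
rewrite hE hE' big_distrlr pair_bigA /=.
rewrite (reindex (@enum_val _ [pred _ : 'I_m * 'I_m' | true])) /=; last first.
  by apply: onW_bij; apply: enum_val_bij.
by apply: eq_bigr => k _; case: enum_val => i j; rewrite mulrACA.
Qed.

Lemma prod_space_sheaf X Y :
  function_sheaf X -> function_sheaf Y -> function_sheaf (prod_space X Y).
Proof.
move=> shX shY.
(* Here the sets D are boxes; two fractions are combined after restriction to the intersection of
   their boxes. *)
pose B (D : set (prod_space X Y)) (F G : prod_space X Y -> K) := exists U V,
  [/\ opn U /\ opn V, tensor_fun U V F /\ tensor_fun U V G & D = [set p | U p.1 /\ V p.2]].
have tcst U V a : tensor_fun U V (fun _ : X * Y => a).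
  have := tensor_fun_pure (reg_cst shX U a) (reg_cst shY V 1).
  by congr tensor_fun; apply/funext => p; rewrite mulr1.
have BI D F G D' F' G' : B D F G -> B D' F' G' -> exists U V,
  [/\ opn U /\ opn V, tensor_fun U V F /\ tensor_fun U V G,
      tensor_fun U V F' /\ tensor_fun U V G' &
      D `&` D' = [set p | U p.1 /\ V p.2]].
  move=> [U [V [[oU oV] [tF tG] ->]]] [U' [V' [[oU' oV'] [tF' tG'] ->]]].
  have subl T (A C : set T) : A `&` C `<=` A by move=> x [].
  have subr T (A C : set T) : A `&` C `<=` C by move=> x [].
  exists (U `&` U'), (V `&` V'); split; first by split; apply: opnI.
  - by split; apply: (tensor_fun_sub shX shY oU oV).
  - by split; apply: (tensor_fun_sub shX shY oU' oV').
  - by apply/seteqP; split=> p /=; [move=> [[? ?] [? ?]]|move=> [[? ?] [? ?]]].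
apply: (@base_sheaf (prod_space X Y) B).
- move=> W; split=> oW p /oW.
    move=> [U [V [h [[oU oV] [Up Vp] th hp hW]]]].
    exists [set p | U p.1 /\ V p.2], h, h; split=> //; last by move=> q []; apply: hW.
    by exists U, V.
  move=> [_ [F [G [[U [V [[oU oV] [tF tG] ->]]] [Up Vp] Gp GW]]]].
  by exists U, V, G; split=> // q ? ?; apply: GW.
- move=> W f; split=> rf p /rf.
    move=> [U [V [h [h' [[oU oV] [Up Vp] [th th'] hp hW]]]]].
    exists [set p | U p.1 /\ V p.2], h, h'; split=> //.
      by exists U, V.
    by move=> q Wq []; apply: hW.
  move=> [_ [F [G [[U [V [[oU oV] [tF tG] ->]]] [Up Vp] Gp GW]]]].
  by exists U, V, F, G; split=> // q ? ? ?; apply: GW.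
- move=> a; exists setT, setT; split; [split; exact: opn_setT| by [] |].
  by apply/seteqP.
- by move=> D F G [U [V [? [? ?] ?]]]; exists U, V.
- by move=> D F G [U [V [? [? ?] ?]]]; exists U, V.
- move=> D F G D' F' G' b b'; have [U [V [? [? ?] [? ?] ->]]] := BI _ _ _ _ _ _ b b'.
  by exists U, V; split=> //; split; apply: tensor_funM.
- move=> D F G D' F' G' b b'; have [U [V [? [? ?] [? ?] ->]]] := BI _ _ _ _ _ _ b b'.
  exists U, V; split=> //; split; last exact: tensor_funM.
  by apply: tensor_funD; apply: tensor_funM.
Qed.

Lemma morphism_fst X Y : function_sheaf X -> function_sheaf Y ->
  morphism (fun p : prod_space X Y => p.1).
Proof.
move=> shX shY V oV.
have t g : reg V g -> tensor_fun V [set: Y] (fun p => g p.1).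
  move=> rg; have := tensor_fun_pure rg (reg_cst shY setT 1).
  by congr tensor_fun; apply/funext => p; rewrite mulr1.
split=> [p Vp|g rg p Vp]; exists V, setT.
  exists (fun=> 1); split=> //; [by split=> //; apply: opn_setT|
    by apply: (t (fun=> 1)); apply: reg_cst|exact: oner_neq0].
exists (fun p => g p.1), (fun=> 1); split=> //.
- by split=> //; apply: opn_setT.
- by split; [apply: t|apply: (t (fun=> 1)); apply: reg_cst].
- exact: oner_neq0.
- by move=> q _ _ _ _ /=; rewrite divr1.
Qed.

Lemma morphism_snd X Y : function_sheaf X -> function_sheaf Y ->
  morphism (fun p : prod_space X Y => p.2).
Proof.
move=> shX shY V oV.
have t g : reg V g -> tensor_fun [set: X] V (fun p => g p.2).
  move=> rg; have := tensor_fun_pure (reg_cst shX setT 1) rg.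
  by congr tensor_fun; apply/funext => p; rewrite mul1r.
split=> [p Vp|g rg p Vp]; exists setT, V.
  exists (fun=> 1); split=> //; [by split=> //; apply: opn_setT|
    by apply: (t (fun=> 1)); apply: reg_cst|exact: oner_neq0].
exists (fun p => g p.2), (fun=> 1); split=> //.
- by split=> //; apply: opn_setT.
- by split; [apply: t|apply: (t (fun=> 1)); apply: reg_cst].
- exact: oner_neq0.
- by move=> q _ _ _ _ /=; rewrite divr1.
Qed.

Lemma morphism_comp X Y Z (f : X -> Y) (g : Y -> Z) :
  morphism f -> morphism g -> morphism (g \o f).
Proof.
move=> mf mg V oV; have [oW rW] := mg V oV; have [oU rU] := mf _ oW.
by split=> // h /rW/rU.
Qed.

Lemma morphism_sval X (S : set X) : morphism (fun x : subspace S => sval x).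
Proof.
by move=> V oV; split; [exists V|move=> g rg x Vx; exists V, g; split].
Qed.

(** The universal property of a subspace: its open sets are traces and its functions are locally
    restrictions, so both pull back through the ambient space. *)
Lemma morphism_subspace X Y (S : set Y) (f : X -> subspace S) :
  function_sheaf X -> morphism (fun x => sval (f x)) -> morphism f.
Proof.
move=> shX mf _ [V oV ->]; have [oU _] := mf V oV; split=> // g rg.
apply: reg_local => // x /= Vx.
have [W [h [oW Wx rh gh]]] := rg (f x) Vx; have [oW' rW'] := mf W oW.
exists ((fun x => sval (f x)) @^-1` W), (fun x => h (sval (f x))).
by split=> // [|y Vy Wy]; [apply: rW'|rewrite /= gh].
Qed.

Lemma morphism_quotient X Y (E : X -> X -> Prop) (f : quotient_space E -> Y) :
  morphism (f \o class_of E) -> morphism f.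
Proof. by []. Qed.

Lemma morphism_class_of X (E : X -> X -> Prop) :
  morphism (class_of E : X -> quotient_space E).
Proof. by []. Qed.

End Sheaves.

(** * Coordinates on affine and multiprojective spaces *)

Section Coordinates.
Variable K : closedFieldType.
Implicit Types X Y : space K.

Lemma affine_space_sheaf (A : finType) : function_sheaf (affine_space K A).
Proof.
apply: frac_space_sheaf.
- by move=> a; exists a%:MP, 1; split=> t; rewrite ?mevalC ?meval1.
- by move=> F G [P [Q [FE GE]]]; exists Q, P.
- by move=> F G [P [Q [FE GE]]]; exists Q, Q.
- move=> F G F' G' [P [Q [FE GE]]] [P' [Q' [FE' GE']]].
  by exists (P * P'), (Q * Q'); split=> t; rewrite mevalM ?FE ?FE' ?GE ?GE'.
- move=> F G F' G' [P [Q [FE GE]]] [P' [Q' [FE' GE']]].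
  exists (P * Q' + P' * Q), (Q * Q').
  by split=> t; rewrite ?mevalD !mevalM ?FE ?FE' ?GE ?GE'.
Qed.

(** Open sets and functions of affine space come from polynomials, and a polynomial in regular
    functions is regular. *)
Lemma morphism_affine X (A : finType) (f : X -> affine_space K A) :
  function_sheaf X ->
  (forall a, reg [set: X] (fun x => (f x : {ffun A -> K}) a)) -> morphism f.
Proof.
move=> shX rf.
pose ev x : 'I_#|A| -> K := fun k => (f x : {ffun A -> K}) (enum_val k).
have rP P : reg [set: X] (fun x => P.@[ev x]).
  by apply: reg_meval.
have oQ Q : opn [set x | Q.@[ev x] != 0].
  have := opn_neq0 shX (opn_setT shX) (rP Q).
  by congr opn; apply/seteqP; split=> x // [].
move=> V oV; split.
  apply: (opn_local shX) => x /oV[F [G [[P [Q [FE GE]]] Gx GV]]].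
  exists [set x | Q.@[ev x] != 0].
  split; [exact: oQ|by rewrite /= -GE|move=> y Qy].
  by apply: GV; rewrite GE.
move=> g rg; apply: (reg_local shX) => x /rg[F [G [[P [Q [FE GE]]] Gx GV]]].
exists [set x | Q.@[ev x] != 0],
  (fun x => P.@[ev x] *
            (Q.@[ev x])^-1).
split=> //=; first by rewrite -GE.
  apply: (regM shX); first exact: (reg_sub shX (opn_setT shX) (rP P)).
  by apply: (regV shX) => //; apply: (reg_sub shX (opn_setT shX) (rP Q)).
by move=> y Vy Qy; rewrite -GE -FE; apply: GV; rewrite // GE.
Qed.

Lemma reg_coord (A : finType) a :
  reg [set: affine_space K A] (fun t : {ffun A -> K} => t a).
Proof.
move=> x _; exists (fun t : {ffun A -> K} => t a), (fun=> 1); split=> //.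
- exists 'X_(enum_rank a), 1.
  by split=> t; rewrite ?mevalXU ?enum_rankK ?meval1.
- exact: oner_neq0.
- by move=> y _ _; rewrite divr1.
Qed.

(** * Homogeneous coordinates and maps to powers of the projective line *)

Lemma hpt_hc (x : P1 K) : hpt (hc x).1 (hc x).2 = x.
Proof.
rewrite /hpt -surjective_pairing; apply: etrans (reprK (x : {eq_quot @proportional K})).
by congr (\pi_ _ _)%qT; apply: val_inj; rewrite val_insubd hc_neq0.
Qed.

Lemma hc_eq (x y : P1 K) : (hc x).1 * (hc y).2 = (hc x).2 * (hc y).1 -> x = y.
Proof.
move=> /eqP xy.
rewrite -[x](reprK (x : {eq_quot @proportional K})).
rewrite -[y in RHS](reprK (y : {eq_quot @proportional K})).
by apply/eqP; rewrite (eqmodE (@proportional_equiv_rel K)).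
Qed.

Lemma hpt_eq (a b c d : K) : (a, b) != (0, 0) -> (c, d) != (0, 0) ->
  hpt a b = hpt c d <-> a * d = b * c.
Proof.
move=> ab cd; have [l l0 lE] := hc_hpt ab; have [k k0 kE] := hc_hpt cd.
split=> [E|E].
  have: (hc (hpt a b)).1 * (hc (hpt c d)).2 = (hc (hpt a b)).2 * (hc (hpt c d)).1.
    by rewrite E mulrC.
  rewrite lE kE /= => {}E; apply: (mulfI (mulf_neq0 l0 k0)).
  by rewrite [LHS]mulrACA E mulrACA.
by apply: hc_eq; rewrite lE kE /= [LHS]mulrACA E mulrACA.
Qed.

Lemma hc_pair_neq0 (x : P1 K) : ((hc x).1, (hc x).2) != (0, 0).
Proof. by rewrite -surjective_pairing hc_neq0. Qed.

Lemma eq_hpt (x : P1 K) (a b : K) : (a, b) != (0, 0) ->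
  x = hpt a b <-> (hc x).1 * b = (hc x).2 * a.
Proof. by move=> ab; rewrite -{1}[x]hpt_hc; apply: hpt_eq; rewrite ?hc_pair_neq0. Qed.

Variable I : finType.
Implicit Types P Q : {mpoly K[#|{: I * bool}|]}.

Lemma multihomogeneousC (a : K) :
  multihomogeneous (fun=> 0%N) (a%:MP : {mpoly K[#|{: I * bool}|]}).
Proof. by move=> m; rewrite msuppC; case: ifP => // _; rewrite inE => /eqP-> i; rewrite !mnmE. Qed.

Lemma multihomogeneousM e e' P Q : multihomogeneous e P ->
  multihomogeneous e' Q -> multihomogeneous (fun i => e i + e' i)%N (P * Q).
Proof.
move=> hP hQ m /msuppM_le /allpairsP[[m1 m2] /= [/hP E1 /hQ E2 ->]] i.
by rewrite !mnmE addnACA E1 E2.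
Qed.

Lemma multihomogeneousD e P Q : multihomogeneous e P ->
  multihomogeneous e Q -> multihomogeneous e (P + Q).
Proof. by move=> hP hQ m /msuppD_le; rewrite mem_cat => /orP[/hP|/hQ]. Qed.

Lemma multihomogeneousN e P : multihomogeneous e P -> multihomogeneous e (- P).
Proof. by move=> hP m; rewrite (perm_mem (msuppN P)) => /hP. Qed.

Lemma hevalN P x : heval (- P) x = - heval P x.
Proof. exact: mevalN. Qed.

Lemma hevalD P Q x : heval (P + Q) x = heval P x + heval Q x.
Proof. exact: mevalD. Qed.

Lemma hevalM P Q x : heval (P * Q) x = heval P x * heval Q x.
Proof. exact: mevalM. Qed.

Lemma P1pow_sheaf : function_sheaf (P1pow K I).
Proof.
apply: frac_space_sheaf.
- move=> a; exists (fun=> 0%N), a%:MP, (1%:MP).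
  by split; try exact: multihomogeneousC; apply/funext => x; rewrite /heval mevalC.
- by move=> F G [e [P [Q [hP hQ -> ->]]]]; exists e, Q, P.
- by move=> F G [e [P [Q [hP hQ _ ->]]]]; exists e, Q, Q.
- move=> _ _ _ _ [e [P [Q [hP hQ -> ->]]]] [e' [P' [Q' [hP' hQ' -> ->]]]].
  exists (fun i => e i + e' i)%N, (P * P'), (Q * Q').
  by split; try exact: multihomogeneousM; apply/funext => x; rewrite hevalM.
- move=> _ _ _ _ [e [P [Q [hP hQ -> ->]]]] [e' [P' [Q' [hP' hQ' -> ->]]]].
  exists (fun i => e i + e' i)%N, (P * Q' + P' * Q), (Q * Q').
  split; try exact: multihomogeneousM.
  + apply: multihomogeneousD; first exact: multihomogeneousM.
    by rewrite mulrC; apply: multihomogeneousM.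
  + by apply/funext => x; rewrite hevalD !hevalM.
  + by apply/funext => x; rewrite hevalM.
Qed.

Definition hvars (a a' : I -> K) : 'I_#|{: I * bool}| -> K :=
  fun k => let: (i, b) := enum_val k in if b then a' i else a i.

Lemma meval_multihomogeneous e P (l a a' : I -> K) : multihomogeneous e P ->
  P.@[hvars (fun i => l i * a i) (fun i => l i * a' i)] =
  (\prod_i l i ^+ e i) * P.@[hvars a a'].
Proof.
move=> hP; rewrite !mevalE mulr_sumr big_seq [RHS]big_seq.
apply: eq_bigr => m /hP mE; rewrite mulrCA; congr (_ * _).
pose h (k : 'I_#|{: I * bool}|) : K := l (enum_val k).1.
rewrite (eq_bigr (fun k => h k ^+ m k * hvars a a' k ^+ m k)); last first.
  by move=> k _; rewrite -exprMn /h /hvars; case: enum_val => i [].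
rewrite big_split /=; congr (_ * _).
rewrite (reindex (@enum_rank {: I * bool})) /=; last exact: onW_bij (enum_rank_bij _).
rewrite (eq_bigr (fun p : I * bool => l p.1 ^+ m (enum_rank (p.1, p.2)))); last first.
  by move=> [i b] _; rewrite /h enum_rankK.
rewrite -(pair_bigA _ (fun i b => l i ^+ m (enum_rank (i, b)))) /=.
apply: eq_bigr => i _; rewrite -mE exprD.
by rewrite big_bool mulrC.
Qed.

(** The factor [u] depends on the multidegree [e] but not on [P], so it cancels in a quotient of two
    forms of the same multidegree. *)
Lemma heval_hpt e (x : {ffun I -> P1 K}) (a a' : I -> K) :
  (forall i, (a i, a' i) != (0, 0) /\ x i = hpt (a i) (a' i)) ->
  exists2 u : K, u != 0 &
    forall P, multihomogeneous e P -> heval P x = u * P.@[hvars a a'].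
Proof.
move=> xE; have /choice[l lE] : forall i, exists l : K,
    l != 0 /\ hc (x i) = (l * a i, l * a' i).
  by move=> i; have [/hc_hpt[l l0 E] ->] := xE i; exists l.
exists (\prod_i l i ^+ e i).
  by apply/prodf_neq0 => i _; rewrite expf_neq0 //; have [] := lE i.
move=> P hP; rewrite -meval_multihomogeneous //; apply: meval_eq => k.
by rewrite /hvars; case: enum_val => i b; have [_ ->] := lE i.
Qed.

(* w is a morphism to P^1; only the local expression of w by regular          *)
(* homogeneous coordinates is used, P^1 itself never becomes a space.         *)
Definition P1_regular X (w : X -> P1 K) := forall x, exists (U : set X) a a',
  [/\ opn U, U x, reg U a, reg U a' &
      forall y, U y -> (a y, a' y) != (0, 0) /\ w y = hpt (a y) (a' y)].

Lemma morphism_P1pow X (f : X -> P1pow K I) : function_sheaf X ->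
  (forall i, P1_regular (fun x => (f x : {ffun I -> P1 K}) i)) -> morphism f.
Proof.
move=> shX rf.
(* As [I] is finite, one neighbourhood of [x] carries regular homogeneous coordinates for all
   components at once. *)
have loc x : exists (U : set X) (a a' : I -> X -> K), [/\ opn U, U x,
    forall P, reg U (fun y => P.@[hvars (a^~ y) (a'^~ y)]) &
    forall y e, U y -> exists2 u : K, u != 0 & forall P,
      multihomogeneous e P -> heval P (f y) = u * P.@[hvars (a^~ y) (a'^~ y)]].
  have /choice[S SE] : forall i, exists s : set X * ((X -> K) * (X -> K)),
      [/\ opn s.1, s.1 x, reg s.1 s.2.1, reg s.1 s.2.2 &
       forall y, s.1 y -> (s.2.1 y, s.2.2 y) != (0, 0) /\
         (f y : {ffun I -> P1 K}) i = hpt (s.2.1 y) (s.2.2 y)].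
    by move=> i; have [U [a [a' H]]] := rf i x; exists (U, (a, a')).
  have [|U [oU Ux UE]] := @opn_bigI _ _ shX I (fun i => (S i).1) x.
    by move=> i; have [] := SE i.
  exists U, (fun i => (S i).2.1), (fun i => (S i).2.2); split=> //.
    move=> P; have := @reg_meval _ _ shX _ P U
      (fun k y => hvars (fun i => (S i).2.1 y) (fun i => (S i).2.2 y) k).
    apply=> k; rewrite /hvars; case: enum_val => i b.
    have [oi _ ra ra' _] := SE i.
    by case: b; [apply: (reg_sub shX oi ra')|apply: (reg_sub shX oi ra)].
  move=> y e Uy; apply: heval_hpt => i; have [_ _ _ _ +] := SE i.
  by apply; apply: UE.
move=> V oV; split.
  apply: (opn_local shX) => x /oV[F [G [[e [P [Q [hP hQ _ ->]]]] Gx GV]]].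
  have [U [a [a' [oU Ux rU UE]]]] := loc x.
  exists [set y | U y /\ Q.@[hvars (a^~ y) (a'^~ y)] != 0].
  split; first exact: (opn_neq0 shX).
    have [u u0 uE] := UE x e Ux; split=> //.
    by move: Gx; rewrite uE // mulf_eq0 negb_or => /andP[].
  move=> y [Uy Qy]; have [u u0 uE] := UE y e Uy.
  by apply: GV; rewrite uE // mulf_neq0.
move=> g rg; apply: (reg_local shX) => x /rg[F [G [[e [P [Q [hP hQ -> ->]]]] Gx GV]]].
have [U [a [a' [oU Ux rU UE]]]] := loc x.
have oUQ := opn_neq0 shX oU (rU Q).
exists [set y | U y /\ Q.@[hvars (a^~ y) (a'^~ y)] != 0],
  (fun y => P.@[hvars (a^~ y) (a'^~ y)] * (Q.@[hvars (a^~ y) (a'^~ y)])^-1).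
split=> //.
- have [u u0 uE] := UE x e Ux; split=> //.
  by move: Gx; rewrite uE // mulf_eq0 negb_or => /andP[].
- apply: (regM shX); first by apply: (reg_sub shX oU (rU P)) => y [].
  by apply: (regV shX) => [|y []//]; apply: (reg_sub shX oU (rU Q)) => y [].
- move=> y Vy [Uy Qy]; have [u u0 uE] := UE y e Uy.
  have -> : (g \o f) y = heval P (f y) / heval Q (f y).
    by apply: GV; rewrite // uE // mulf_neq0.
  by rewrite !uE // -mulf_div divff // mul1r.
Qed.

Definition hvar (i : I) (b : bool) : {mpoly K[#|{: I * bool}|]} :=
  'X_(enum_rank (i, b)).

Lemma heval_hvar i b x :
  heval (hvar i b) x = if b then (hc (x i)).2 else (hc (x i)).1.
Proof. by rewrite /heval mevalXU enum_rankK. Qed.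

Lemma multihomogeneous_hvar i b : multihomogeneous (fun j => (j == i) : nat) (hvar i b).
Proof.
move=> m; rewrite msuppX inE => /eqP-> j; rewrite !mnmE.
rewrite !(inj_eq enum_rank_inj) !xpair_eqE eq_sym.
by case: eqVneq; case: b.
Qed.

Lemma opn_hc_neq0 i b :
  opn [set x : P1pow K I | (if b then (hc ((x : {ffun I -> P1 K}) i)).2
                            else (hc ((x : {ffun I -> P1 K}) i)).1) != 0].
Proof.
move=> x /= nz; exists (heval (hvar i b)), (heval (hvar i b)).
split; first by exists (fun j => (j == i) : nat), (hvar i b), (hvar i b);
  split=> //; apply: multihomogeneous_hvar.
  by rewrite heval_hvar.
by move=> y; rewrite heval_hvar.
Qed.

Lemma reg_hc_ratio i b :
  reg [set x : P1pow K I | (if b then (hc ((x : {ffun I -> P1 K}) i)).2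
                            else (hc ((x : {ffun I -> P1 K}) i)).1) != 0]
    (fun x : {ffun I -> P1 K} => (if b then (hc (x i)).1 else (hc (x i)).2) /
                                 (if b then (hc (x i)).2 else (hc (x i)).1)).
Proof.
move=> x /= nz; exists (heval (hvar i (~~ b))), (heval (hvar i b)); split.
- by exists (fun j => (j == i) : nat), (hvar i (~~ b)), (hvar i b);
  split=> //; apply: multihomogeneous_hvar.
- by rewrite heval_hvar.
- by move=> y _ _; rewrite !heval_hvar; case: (b).
Qed.

(** The representative chosen by [hc] need not vary regularly; (c / c' : 1) and (1 : c' / c) do,
    where their denominators are nonzero. *)
Lemma P1_regular_coord i :
  P1_regular (fun x : P1pow K I => (x : {ffun I -> P1 K}) i).
Proof.
move=> x; have [b xb] : exists b : bool, (if b then (hc ((x : {ffun I -> P1 K}) i)).2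
                            else (hc ((x : {ffun I -> P1 K}) i)).1) != 0.
  have := hc_pair_neq0 ((x : {ffun I -> P1 K}) i).
  by rewrite xpair_eqE negb_and => /orP[]; [exists false|exists true].
pose q b (x : {ffun I -> P1 K}) := (if b then (hc (x i)).1 else (hc (x i)).2) /
                                 (if b then (hc (x i)).2 else (hc (x i)).1).
exists [set x : P1pow K I | (if b then (hc ((x : {ffun I -> P1 K}) i)).2
                            else (hc ((x : {ffun I -> P1 K}) i)).1) != 0].
have rq := @reg_hc_ratio i b; have r1 := reg_cst P1pow_sheaf _ 1.
exists (if b then q b else fun=> 1), (if b then fun=> 1 else q b).
split=> //; first exact: (@opn_hc_neq0 i b).
- by case: (b) rq => // _; exact: r1.
- by case: (b) rq => // _; exact: r1.
- rewrite /q => y; case: (b) => /= y0.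
    have nz : ((hc (y i)).1 / (hc (y i)).2, 1 : K) != (0, 0).
      by rewrite xpair_eqE oner_eq0 andbF.
    by split=> //; apply/eq_hpt => //; rewrite mulr1 mulrC divfK.
  have nz : (1 : K, (hc (y i)).2 / (hc (y i)).1) != (0, 0).
    by rewrite xpair_eqE oner_eq0.
  by split=> //; apply/eq_hpt => //; rewrite mulr1 mulrC divfK.
Qed.

Lemma P1_regular_comp X Y (f : X -> Y) (w : Y -> P1 K) :
  morphism f -> P1_regular w -> P1_regular (w \o f).
Proof.
move=> mf rw x; have [U [a [a' [oU Ux ra ra' wE]]]] := rw (f x).
have [oV rV] := mf U oU; exists (f @^-1` U), (a \o f), (a' \o f).
by split=> //; [apply: rV|apply: rV|move=> y; apply: wE].
Qed.

Lemma P1_regular_morphism X (f : X -> P1pow K I) i :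
  morphism f -> P1_regular (fun x => (f x : {ffun I -> P1 K}) i).
Proof. by move=> mf; apply: (P1_regular_comp mf (P1_regular_coord i)). Qed.

End Coordinates.

(** * Charts *)

Section Charts.
Variable K : closedFieldType.
Implicit Types X Y : space K.

(** An isomorphism of [Y] with an open subset of [X]. The inverse [psi] is a total function,
    constrained only on the range of [phi]. *)
Definition chart Y X (phi : Y -> X) (psi : X -> Y) : Prop :=
  [/\ morphism phi, cancel phi psi, opn (range phi) &
      morphism (fun x : subspace (range phi) => psi (sval x))].

Lemma irreducible_image X Y (f : X -> Y) (Z : set X) :
  morphism f -> irreducible_set Z -> irreducible_set (f @` Z).
Proof.
move=> mf [[z Zz] irrZ]; split; first by exists (f z), z.
move=> U V oU oV [_ [[x Zx <-] Ux]] [_ [[y Zy <-] Vy]].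
have [||w [Zw [Uw Vw]]] := irrZ _ _ (mf _ oU).1 (mf _ oV).1.
- by exists x.
- by exists y.
- by exists (f w); split=> //; exists w.
Qed.

Definition closure X (A : set X) : set X :=
  [set x | forall U : set X, opn U -> U x -> A `&` U !=set0].

Lemma opn_setC_closure X (A : set X) : function_sheaf X -> opn (~` closure A).
Proof.
move=> shX; apply: (opn_local shX) => x /existsNP[U /not_implyP[oU]].
move=> /not_implyP[Ux AU]; exists U; split=> // y Uy; apply/existsNP.
by exists U; move=> /(_ oU Uy).
Qed.

Lemma subset_closure X (A : set X) : A `<=` closure A.
Proof. by move=> x Ax U _ Ux; exists x. Qed.

Lemma closure_subset X (A B : set X) : A `<=` B -> closure A `<=` closure B.
Proof. by move=> AB x Ax U oU /(Ax U oU)[y [/AB By Uy]]; exists y. Qed.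

Lemma irreducible_closure X (A : set X) :
  irreducible_set A -> irreducible_set (closure A).
Proof.
move=> [[a Aa] irrA]; split; first by exists a; apply: subset_closure.
move=> U V oU oV [x [Ax Ux]] [y [Ay Vy]].
have [w [Aw UVw]] := irrA _ _ oU oV (Ax U oU Ux) (Ay V oV Vy).
by exists w; split=> //; apply: subset_closure.
Qed.

Section OneChart.
Variables (X Y : space K) (shX : function_sheaf X) (shY : function_sheaf Y).
Variables (phi : Y -> X) (psi : X -> Y) (ch : chart phi psi).

Lemma chart_open (V : set Y) : opn V -> opn (phi @` V).
Proof.
case: ch => _ phiK oR mpsi oV; have [[W oW WE] _] := mpsi V oV.
have -> : phi @` V = W `&` range phi; last exact: opnI.
apply/seteqP; split=> [_ [y Vy <-]|x [Wx [y _ yE]]].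
  split; last by exists y.
  have Ry : range phi (phi y) by exists y.
  change ((fun x : subspace (range phi) => W (sval x)) (exist _ (phi y) Ry)).
  by rewrite -WE /= phiK.
subst; have Ry : range phi (phi y) by exists y.
exists y => //; rewrite -[y]phiK.
change (((fun x : subspace (range phi) => psi (sval x)) @^-1` V)
          (exist _ (phi y) Ry)).
by rewrite WE.
Qed.

Lemma chart_open_immersion : open_immersion phi.
Proof.
case: ch => mphi phiK oR mpsi; split=> //.
have Ry y : range phi (phi y) by exists y.
exists (fun y => exist _ (phi y) (Ry y)) => //; split.
  exact: morphism_subspace.
exists (fun x => psi (sval x)); split=> // -[x Rx] /=; have [y _ yE] := Rx.
by subst; apply: eq_exist; rewrite phiK.
Qed.

Lemma chart_reg_at y f : reg_at y f -> reg_at (phi y) (f \o psi).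
Proof.
case: ch => mphi phiK oR mpsi [U [oU Uy rf]].
have Ry : range phi (phi y) by exists y.
have [_ rpsi] := mpsi U oU.
exists (phi @` U); split; [exact: chart_open|by exists y|].
apply: (reg_local shX) => _ [z Uz <-].
have Rz : range phi (phi z) by exists z.
have [|V [h [oV Vz rh hE]]] := rpsi f rf (exist _ (phi z) Rz).
  by rewrite /= phiK.
exists V, h; split=> // _ [t Ut <-] Vt.
have Rt : range phi (phi t) by exists t.
by apply: (hE (exist _ (phi t) Rt)); rewrite //= phiK.
Qed.

Lemma morphism_reg_at (f : Y -> X) y g :
  morphism f -> reg_at (f y) g -> reg_at y (g \o f).
Proof.
move=> mf [U [oU Uy rg]]; have [oV rV] := mf U oU.
by exists (f @^-1` U); split=> //; apply: rV.
Qed.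

(** Composition with [phi] and with [psi] transports derivations both ways. Values of f \o psi
    outside the open range of [phi] are arbitrary, but a tangent vector sees only germs. *)
Lemma tangent_dimension_chart y d :
  tangent_dimension y d -> tangent_dimension (phi y) d.
Proof.
have [mphi phiK oR mpsi] := ch.
have psiK f : (f \o psi) \o phi = f :> (Y -> K).
  by apply/funext => z /=; rewrite phiK.
have near f g : near_eq (phi y) f g -> near_eq y (f \o phi) (g \o phi).
  move=> [U [oU Uy fg]]; have [oV _] := mphi U oU.
  by exists (phi @^-1` U); split=> // z; apply: fg.
have near' f g : near_eq y f g -> near_eq (phi y) (f \o psi) (g \o psi).
  move=> [U [oU Uy fg]]; exists (phi @` U).
  split; [exact: chart_open|by exists y|] => _ [z Uz <-] /=.
  by rewrite phiK fg.
have nearK f : near_eq (phi y) f ((f \o phi) \o psi).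
  exists (range phi); split=> //.
  by move=> _ [z _ <-] /=; rewrite phiK.
move=> [b [bT bB]]; exists (fun i f => b i (f \o phi)); split.
  move=> i f g /(morphism_reg_at mphi) rf /(morphism_reg_at mphi) rg.
  have [E1 E2 E3] := bT i _ _ rf rg.
  by split=> // /near; apply: E1.
move=> D TD; have [|a [aE aU]] := bB (fun g => D (g \o psi)).
  move=> f g /chart_reg_at rf /chart_reg_at rg.
  have [E1 E2 E3] := TD _ _ rf rg.
  split=> [/near'|a|]; [exact: E1|exact: E2|].
  by apply: etrans E3 _; rewrite /= phiK.
exists a; split.
  move=> f rf; have rf' := morphism_reg_at mphi rf.
  have [E1 _ _] := TD _ _ rf (chart_reg_at rf').
  by apply: etrans (aE _ rf'); apply: E1.
move=> a' a'E; apply: aU => f rf.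
rewrite (a'E _ (chart_reg_at rf)); apply: eq_bigr => i _.
by rewrite psiK.
Qed.

Lemma irreducible_chart (U : set X) :
  irreducible Y -> opn U -> U `&` range phi !=set0 ->
  forall V, opn V -> V `&` range phi !=set0 -> U `&` V `&` range phi !=set0.
Proof.
case: ch => mphi _ _ _ [_ irrY] oU [u [Ux [y _ yE]]] V oV [v [Vx [z _ zE]]].
subst.
have [||w [_ [Uw Vw]]] := irrY _ _ (mphi U oU).1 (mphi V oV).1.
- by exists y.
- by exists z.
- by exists (phi w); split=> //; exists w.
Qed.

(** The closures stay distinct: if [y] lies outside the closed set Z i, then the image of ~[Z i is
    an open set that contains phi y and misses phi @] Z i. *)
Lemma irreducible_chain_chart_image d (Z : nat -> set Y) :
  irreducible_chain d Z -> irreducible_chain d (fun i => closure (phi @` Z i)).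
Proof.
case: ch => mphi phiK _ _ [Zirr Zinc]; split=> i i_le.
  split; first exact: opn_setC_closure.
  by apply/irreducible_closure/irreducible_image => //; case: (Zirr i i_le).
have [Zii [y Zy nZy]] : Z i `<=` Z i.+1 /\ exists2 y, Z i.+1 y & ~ Z i y.
  have [sub nsub] := Zinc i i_le; split=> //.
  by have /existsNP[y /not_implyP[]] := nsub; exists y.
split; first by apply: closure_subset => _ [z Zz <-]; exists z => //; apply: Zii.
move=> CC; have H : closure (phi @` Z i) (phi y).
  by apply: CC; apply: subset_closure; exists y.
have [oC _] := Zirr i (ltnW i_le).
have [||_ [[z Zz <-] [t nZt tE]]] := H (phi @` (~` Z i)).
- exact: chart_open.
- by exists y.
by apply: nZt; rewrite -(phiK t) tE phiK.
Qed.

(** If the smallest member of a chain meets the chart, then so do all of them, and the chain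
    restricts to one of the same length. A bound on chains in [Y] therefore bounds those of [X]. *)
Lemma irreducible_chain_chart_preimage d (Z : nat -> set X) y :
  Z 0%N (phi y) -> irreducible_chain d Z ->
  irreducible_chain d (fun i => phi @^-1` Z i).
Proof.
have [mphi phiK oR mpsi] := ch.
move=> Z0y [Zirr Zinc].
have Zy i : (i <= d)%N -> Z i (phi y).
  by elim: i => // i IHi i_lt; have [+ _] := Zinc i i_lt; apply; apply/IHi/ltnW.
have irr i : (i <= d)%N -> irreducible_set (phi @^-1` Z i).
  move=> i_le; have [_ [_ Zi]] := Zirr i i_le.
  split; first by exists y; apply: Zy.
  move=> U V oU oV [u [Zu Uu]] [v [Zv Vv]].
  have [||x [Zw [[w Uw wE] [t Vt tE]]]] :=
      Zi _ _ (chart_open oU) (chart_open oV).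
  - by exists (phi u); split=> //; exists u.
  - by exists (phi v); split=> //; exists v.
  by exists w; subst; split=> //; split=> //; rewrite -(phiK w) -tE phiK.
split=> i i_le.
  by split; [apply: (mphi _ (Zirr i i_le).1).1|apply: irr].
have [sub nsub] := Zinc i i_le; split; first by move=> z; apply: sub.
have /existsNP[x /not_implyP[Zx nZx]] := nsub; move=> sub'.
(* The open subsets range phi and ~` Z i of X both meet Z i.+1, so there is a *)
(* point of Z i.+1 in their intersection.                                     *)
have [oZ _] := Zirr i (ltnW i_le); have [_ [_ Zi]] := Zirr _ i_le.
have [||z [Zw [[w _ wE] nZw]]] := Zi _ _ oR oZ.
- by exists (phi y); split; [apply: Zy|exists y].
- by exists x.
by subst; apply: nZw; apply: sub'.
Qed.

End OneChart.

Section Atlas.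
Variables (X Y : space K) (shX : function_sheaf X) (shY : function_sheaf Y).
Hypothesis atlas : forall x : X, exists phi psi,
  chart (phi : Y -> X) psi /\ range phi x.

Lemma dimension_atlas (x : X) d : dimension Y d -> dimension X d.
Proof.
move=> [[Z Zch] dmax]; split.
  have [phi [psi [ch _]]] := atlas x.
  by exists (fun i => closure (phi @` Z i)); apply: (irreducible_chain_chart_image _ ch).
move=> m T Tch; have [Tirr _] := Tch; have [_ [[z Tz] _]] := Tirr 0%N (leq0n m).
have [phi [psi [ch [y _ yE]]]] := atlas z; subst.
exact: dmax (irreducible_chain_chart_preimage shX ch Tz Tch).
Qed.

Lemma smooth_atlas (x : X) d : dimension Y d ->
  (forall y : Y, tangent_dimension y d) -> smooth X.
Proof.
move=> dimY tanY; exists d; first exact: dimension_atlas.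
move=> z; have [phi [psi [ch [y _ <-]]]] := atlas z.
exact: (tangent_dimension_chart shX ch).
Qed.

End Atlas.

(** Two charts overlap at [o], so nonempty open sets can be moved from one irreducible chart into
    the other. *)
Lemma irreducible_atlas X Y (o : X) : irreducible Y ->
  (forall x : X, exists phi psi,
     [/\ chart (phi : Y -> X) psi, range phi x & range phi o]) ->
  irreducible X.
Proof.
move=> irrY atlas; split; first by exists o.
move=> U V oU oV [x [_ Ux]] [y [_ Vy]].
have [phi [psi [ch Rx Ro]]] := atlas x; have [phi' [psi' [ch' Ry Ro']]] := atlas y.
have [_ _ oR _] := ch; have [_ _ oR' _] := ch'.
(* Inside the chart [phi], the set U (at x) and the range of phi' (at o) must meet; then U and V are
   compared inside phi'. *)
have [z [[Uz R'z] Rz]] : U `&` range phi' `&` range phi !=set0.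
  by apply: (irreducible_chart ch irrY) => //; [exists x|exists o].
have [w [[Uw Vw] _]] : U `&` V `&` range phi' !=set0.
  by apply: (irreducible_chart ch' irrY) => //; [exists z|exists y].
by exists w.
Qed.

End Charts.

(** * Irreducibility and dimension of affine space *)

Section Polynomials.
Variable K : closedFieldType.

Lemma mpoly_ring_ind n (T : {mpoly K[n]} -> Prop) :
  (forall c, T c%:MP) -> (forall i, T 'X_i) ->
  (forall p q, T p -> T q -> T (p + q)) ->
  (forall p q, T p -> T q -> T (p * q)) -> forall p, T p.
Proof.
move=> TC TX TD TM p; rewrite [p]mpolyE; apply: (big_ind T) => //; first by rewrite -mpolyC0.
move=> m _; rewrite -mul_mpolyC mpolyXE_id; apply: (TM) => //.
have T1 : T 1 by rewrite -mpolyC1.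
apply: (big_ind T) => // i _; elim: (m i) => [|k IHk] //.
by rewrite exprS; apply: TM.
Qed.

(** A crude count: every exponent of a monomial of degree less than d is less than d. *)
Lemma card_bmultinom_le n d : (#|{: 'X_{1..n < d}}| <= d ^ n)%N.
Proof.
have lt_m (m : 'X_{1..n < d}) i : (m i < d)%N.
  apply: leq_ltn_trans (bmdeg m).
  by rewrite mdegE (bigD1 i) //= leq_addr.
rewrite -[leqRHS](_ : #|{ffun 'I_n -> 'I_d}| = _); last first.
  by rewrite card_ffun !card_ord.
apply: (@leq_card _ _ (fun m : 'X_{1..n < d} => [ffun i => Ordinal (lt_m m i)])).
move=> m1 m2 /ffunP E; apply: val_inj; apply/mnmP => i.
by have := E i; rewrite !ffunE => /(congr1 val).
Qed.

(** Polynomials that outnumber the available monomials have linearly dependent coefficient rows; a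
    nonzero row of the kernel of their matrix is the relation. *)
Lemma mpoly_dependent n s (I : finType) (u : I -> {mpoly K[n]}) :
  (forall j, msize (u j) <= s)%N -> (s ^ n < #|I|)%N ->
  exists2 c : I -> K, exists j, c j != 0 &
    forall v, \sum_j c j * (u j).@[v] = 0.
Proof.
move=> us ltI.
pose A : 'M[K]_(#|I|, #|{: 'X_{1..n < s}}|) :=
  \matrix_(j, m) (u (enum_val j))@_(enum_val m : 'X_{1..n < s}).
have : kermx A != 0.
  rewrite kermx_eq0 /row_free neq_ltn.
  by rewrite (leq_ltn_trans (rank_leq_col A)) // (leq_ltn_trans (card_bmultinom_le n s)).
case/rowV0Pn => w /sub_kermxP wA w0.
exists (fun j => w 0 (enum_rank j)).
  have /rV0Pn[j wj] := w0; exists (enum_val j); by rewrite enum_valK.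
move=> v; pose M m := (\prod_(i < n) v i ^+ (m : 'X_{1..n < s}) i).
have uE j : (u j).@[v] = \sum_(m : 'X_{1..n < s}) (u j)@_m * M m.
  rewrite {1}(mpolywE (us j)) raddf_sum; apply: eq_bigr => m _.
  by rewrite /= mevalZ mevalX.
under eq_bigr do rewrite uE mulr_sumr.
rewrite exchange_big big1 // => m _.
under eq_bigr do rewrite mulrA.
rewrite -mulr_suml; apply/eqP; rewrite mulf_eq0; apply/orP; left; apply/eqP.
have /matrixP/(_ 0 (enum_rank m)) := wA; rewrite !mxE => {2}<-.
rewrite (reindex (@enum_val I I)) /=; last exact: onW_bij (enum_val_bij I).
by apply: eq_bigr => j _; rewrite !mxE enum_valK enum_rankK.
Qed.

End Polynomials.

Section AffineSpace.
Variables (K : closedFieldType) (A : finType).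
Local Notation n := #|A|.
Local Notation AA := (affine_space K A).
Implicit Types (t v : {ffun A -> K}) (P Q : {mpoly K[n]}).

Definition aeval P t : K := P.@[fun k => t (enum_val k)].

Lemma aevalD P Q t : aeval (P + Q) t = aeval P t + aeval Q t.
Proof. exact: mevalD. Qed.
Lemma aevalM P Q t : aeval (P * Q) t = aeval P t * aeval Q t.
Proof. exact: mevalM. Qed.
Lemma aevalC c t : aeval c%:MP t = c.
Proof. exact: mevalC. Qed.
Lemma aeval0 t : aeval 0 t = 0.
Proof. exact: meval0. Qed.
Lemma aeval1 t : aeval 1 t = 1.
Proof. exact: meval1. Qed.
Lemma aevalX i t : aeval 'X_i t = t (enum_val i).
Proof. exact: mevalXU. Qed.

Lemma opn_aeval P : opn [set t : AA | aeval P t != 0].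
Proof. by move=> t Pt; exists (aeval P), (aeval P); split=> //; exists P, P. Qed.

Lemma opn_affine (U : set AA) t : opn U -> U t ->
  exists2 P, aeval P t != 0 & forall s : AA, aeval P s != 0 -> U s.
Proof.
move=> oU /oU[F [G [[P [Q [_ /funext->]]] Qt QU]]].
by exists Q.
Qed.

Definition line t v (s : K) : {ffun A -> K} := [ffun a => t a + s * v a].

Lemma line0 t v : line t v 0 = t.
Proof. by apply/ffunP => a; rewrite ffunE mul0r addr0. Qed.

Lemma aeval_mderivX i j t : aeval ('X_j)^`M(i) t = (i == j)%:R.
Proof.
rewrite mderivX mnm1E eq_sym; case: eqP => [->|_].
  have -> : (U_(j) - U_(j))%MM = 0%MM :> 'X_{1..n}.
    by apply/mnmP => k; rewrite !mnmE subnn.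
  by rewrite mpolyX0 scale1r aeval1.
by rewrite scale0r aeval0.
Qed.

(** Restriction to a coordinate line turns a partial derivative into the derivative of a univariate
    polynomial, for which vanishing at all points of the infinite field means being 0. *)
Lemma aeval_line P t i : exists L : {poly K},
  (forall s, L.[s] = aeval P (line t [ffun a => (a == enum_val i)%:R] s)) /\
  L^`().[0] = aeval P^`M(i) t.
Proof.
elim/mpoly_ring_ind: P => [c|j|P Q [L [LE L']] [M [ME M']]|P Q [L [LE L']] [M [ME M']]].
- exists c%:P; split=> [s|]; first by rewrite hornerC aevalC.
  by rewrite derivC mderivC horner0 aeval0.
- exists ((t (enum_val j))%:P + ((j == i)%:R)%:P * 'X); split=> [s|].
    by rewrite !hornerE aevalX !ffunE (inj_eq enum_val_inj) mulrC.
  rewrite derivD derivC add0r derivM derivC mul0r add0r derivX mulr1 hornerC.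
  by rewrite aeval_mderivX eq_sym.
- exists (L + M); split=> [s|]; first by rewrite hornerD LE ME aevalD.
  by rewrite derivD hornerD mderivD aevalD L' M'.
- exists (L * M); split=> [s|]; first by rewrite hornerM LE ME aevalM.
  by rewrite derivM hornerD !hornerM mderivM aevalD !aevalM L' M' LE ME !line0.
Qed.

Lemma aeval_line_poly P t v : exists L : {poly K},
  forall s, L.[s] = aeval P (line t v s).
Proof.
elim/mpoly_ring_ind: P => [c|j|P Q [L LE] [M ME]|P Q [L LE] [M ME]].
- by exists c%:P => s; rewrite hornerC aevalC.
- exists ((t (enum_val j))%:P + (v (enum_val j))%:P * 'X) => s.
  by rewrite !hornerE aevalX ffunE mulrC.
- by exists (L + M) => s; rewrite hornerD LE ME aevalD.
- by exists (L * M) => s; rewrite hornerM LE ME aevalM.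
Qed.

Lemma poly_horner_eq0 (p : {poly K}) : (forall s, p.[s] = 0) -> p = 0.
Proof.
move=> p0; apply/eqP/negPn/negP => /closed_nonrootP[s].
by rewrite /root p0 eqxx.
Qed.

(** Join a point of one basic open set to a point of the other by a line in [Z]. Both defining
    polynomials restrict to nonzero univariate polynomials, whose product has a nonroot in a closed
    field. *)
Lemma irreducible_line (Z : set AA) : Z !=set0 ->
  (forall t t' s, Z t -> Z t' -> Z (line t [ffun a => t' a - t a] s)) ->
  irreducible_set Z.
Proof.
move=> Z0 Zline; split=> // U V oU oV [p [Zp Up]] [q [Zq Vq]].
have [P Pp PU] := opn_affine oU Up; have [Q Qq QV] := opn_affine oV Vq.
set v : {ffun A -> K} := [ffun a => (q : {ffun A -> K}) a - (p : {ffun A -> K}) a].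
have [L LE] := aeval_line_poly P p v; have [M ME] := aeval_line_poly Q p v.
have /closed_nonrootP[s] : L * M != 0.
  have LP : L.[0] = aeval P p by rewrite LE line0.
  have MQ : M.[1] = aeval Q q.
    by rewrite ME; congr aeval; apply/ffunP => a; rewrite !ffunE mul1r addrC subrK.
  rewrite mulf_neq0 //.
    by apply: contraNneq Pp => L0; rewrite -LP L0 horner0.
  by apply: contraNneq Qq => M0; rewrite -MQ M0 horner0.
rewrite /root hornerM mulf_eq0 negb_or LE ME => /andP[Ls Ms].
by exists (line p v s); split; [apply: Zline|split; [apply: PU|apply: QV]].
Qed.

Lemma irreducible_affine_space : irreducible AA.
Proof. by apply: irreducible_line => //; exists [ffun=> 0]. Qed.

Lemma irreducible_chain_coord :
  irreducible_chain n (fun i => [set t : AA |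
    forall k : 'I_n, (i <= k)%N -> (t : {ffun A -> K}) (enum_val k) = 0]).
Proof.
split=> i i_le.
  split.
    move=> t /= /existsNP[k /not_implyP[ik /eqP tk]].
    exists (aeval 'X_k), (aeval 'X_k); split; first by exists 'X_k, 'X_k.
      by rewrite aevalX.
    move=> s; rewrite aevalX => /eqP sk Zs; apply: sk.
    exact: Zs.
  apply: irreducible_line; first by exists [ffun=> 0] => k _; rewrite ffunE.
  move=> t t' s Zt Zt' k ik.
  by rewrite !ffunE Zt // Zt' // subrr mulr0 addr0.
split; first by move=> t Zt k ik; apply/Zt/ltnW.
pose k0 := Ordinal i_le.
move=> sub; pose t : {ffun A -> K} := [ffun a => (a == enum_val k0)%:R].
have Zt : [set t : AA | forall k : 'I_n, (i < k)%N ->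
    (t : {ffun A -> K}) (enum_val k) = 0] t.
  move=> k ik; rewrite ffunE (inj_eq enum_val_inj); case: eqP => // kE.
  by move: ik; rewrite kE ltnn.
by have /eqP := sub t Zt k0 (leqnn _); rewrite ffunE eqxx oner_eq0.
Qed.

(** * The bound on chains of irreducible closed sets *)

Definition independent_on (Z : set AA) (I : finType) (u : I -> {mpoly K[n]}) :=
  forall c : I -> K,
    (forall t, Z t -> \sum_j c j * aeval (u j) t = 0) -> forall j, c j = 0.

(* If g vanishes on Z' but not on Z, then in a relation P(g, u) = 0 on Z one  *)
(* may divide by a power of g and then restrict to Z', where g vanishes.      *)
Lemma independent_on_powers (Z Z' : set AA) D (I : finType) u g :
  irreducible_set Z -> Z' `<=` Z -> (forall t, Z' t -> aeval g t = 0) ->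
  (exists2 t, Z t & aeval g t != 0) -> @independent_on Z' I u ->
  @independent_on Z ('I_D * I)%type (fun ji => g ^+ ji.1 * u ji.2).
Proof.
move=> [_ irrZ] sub g0 [z Zz gz] indu c cE.
suff H j : forall k (jD : (j < D)%N), c (Ordinal jD, k) = 0.
  by move=> [[j jD] k]; apply: H.
elim/ltn_ind: j => j IHj k jD.
pose S l : {mpoly K[n]} := \sum_k c (l, k) *: u k.
(* By induction the coefficients of exponents below j vanish, so the relation on [Z] reads g^j R =
   0; on Z' the factor [g] leaves only S_j of [R]. *)
pose R := S (Ordinal jD) +
  g * \sum_(l < D | (j < l)%N) g ^+ (l - j.+1) * S l.
have SE l t : aeval (S l) t = \sum_k c (l, k) * aeval (u k) t.
  by rewrite /aeval raddf_sum; apply: eq_bigr => i _; rewrite /= mevalZ.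
have gR t : Z t -> aeval g t ^+ j * aeval R t = 0.
  move=> /cE E0.
  have {E0} : \sum_(l < D) \sum_k c (l, k) * aeval (g ^+ l * u k) t = 0.
    by rewrite pair_bigA -[RHS]E0; apply: eq_bigr => -[].
  rewrite (eq_bigr (fun l : 'I_D => aeval g t ^+ l * aeval (S l) t)); last first.
    move=> l _; rewrite SE mulr_sumr; apply: eq_bigr => i _.
    by rewrite aevalM mulrCA /aeval rmorphXn.
  rewrite (bigID (fun l : 'I_D => (j < l)%N)) /= addrC.
  rewrite (bigD1 (Ordinal jD)) /=; last by rewrite ltnn.
  rewrite [X in _ + X + _]big1 ?addr0; last first.
    move=> l /andP[jl nl]; rewrite SE big1 ?mulr0 // => i _.
    have lj : (l < j)%N.
      by rewrite ltn_neqAle leqNgt jl andbT; apply: contraNneq nl => E; apply/eqP/val_inj.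
    by case: l lj {jl nl} => l lD /= lj; rewrite IHj // mul0r.
  move=> E; rewrite aevalD aevalM mulrDr -[RHS]E; congr (_ + _).
  rewrite [aeval (\sum_(_ < _ | _) _) _]raddf_sum !mulr_sumr.
  apply: eq_bigr => l jl; rewrite /= -!/(aeval _ _) mulrA -exprSr aevalM.
  by rewrite [aeval (_ ^+ _) _]rmorphXn mulrA -exprD subnKC.
have R0 t : Z t -> aeval R t = 0.
  move=> Zt; apply/eqP/negPn/negP => Rt.
  (* Irreducibility allows cancelling g^j: otherwise [g] and [R] would both be nonzero at some point
     of [Z]. *)
  have [||w [Zw [/= gw Rw]]] := irrZ _ _ (@opn_aeval g) (@opn_aeval R).
  - by exists z.
  - by exists t.
  by have /eqP := gR w Zw; rewrite mulf_eq0 expf_eq0 (negPf gw) andbF (negPf Rw).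
apply: (indu (fun k => c (Ordinal jD, k))) => t Z't.
have := R0 t (sub t Z't); rewrite aevalD aevalM g0 // mul0r addr0 SE //.
Qed.

(** The polynomials are the products of powers, with exponents below D, of i functions, each
    vanishing on one member of the chain but not on the next. The constant [B] is fixed before [D],
    so sizes grow only linearly in [D] while the number of polynomials is D^i. *)
Lemma irreducible_chain_independent d (Z : nat -> set AA) :
  irreducible_chain d Z -> forall i, (i <= d)%N -> exists B, forall D,
    exists (I : finType) (u : I -> {mpoly K[n]}),
      [/\ #|I| = (D ^ i)%N, forall j, (msize (u j) <= B * D + 1)%N &
          independent_on (Z i) u].
Proof.
move=> [Zirr Zinc]; elim=> [_|i IHi i_lt].
  exists 0%N => D; exists unit, (fun=> 1); split; first by rewrite card_unit.
    by move=> _; rewrite msize1.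
  have [_ [[z Zz] _]] := Zirr 0%N (leq0n d) => c /(_ z Zz).
  by rewrite (big_pred1 tt) => [|[]] //; rewrite /aeval meval1 mulr1 => c0 [].
have [B BE] := IHi (ltnW i_lt).
have [oZ _] := Zirr i (ltnW i_lt); have [_ irrZ] := Zirr _ i_lt.
have [sub nsub] := Zinc i i_lt.
have /existsNP[z /not_implyP[Zz nZz]] := nsub.
have [g gz gZ] := opn_affine oZ nZz.
(* A power of [g] with exponent below [D] adds at most msize g * D to the size. *)
exists (B + msize g)%N => D; have [I [u [Icard usize uind]]] := BE D.
exists ('I_D * I)%type, (fun ji : 'I_D * I => g ^+ ji.1 * u ji.2); split.
- by rewrite card_prod card_ord Icard expnS.
- move=> [j k] /=.
  have [->|u0] := eqVneq (u k) 0; first by rewrite mulr0 msize0.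
  have g0 : g != 0.
    by apply: contraNneq gz => ->; rewrite aeval0.
  have gj : (msize (g ^+ j) <= msize g * j + 1)%N.
    elim: (j : nat) => [|l IHl]; first by rewrite expr0 msize1 muln0.
    rewrite exprS msizeM ?expf_neq0 // mulnS.
    have arith a b c : (b <= c + 1 -> (a + b).-1 <= a + c + 1)%N by lia.
    exact: arith.
  have arith a b c l : (b <= a * l + 1 -> c <= B * D + 1 -> l < D ->
      (b + c).-1 <= (B + a) * D + 1)%N.
    move=> ab cB /ltnW /(leq_mul (leqnn a)); rewrite mulnDl.
    by move: (a * l)%N (a * D)%N (B * D)%N ab cB => e f h; lia.
  rewrite msizeM ?expf_neq0 //; exact: arith gj (usize k) (ltn_ord j).
- apply: (independent_on_powers irrZ sub _ _ uind); last by exists z.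
  by move=> t Zt; apply/eqP/negPn/negP => /gZ.
Qed.

Lemma dimension_affine_space : dimension AA n.
Proof.
split; first by eexists; exact: irreducible_chain_coord.
move=> d Z chZ; rewrite leqNgt; apply/negP => lt_nd.
have [B BE] := irreducible_chain_independent chZ (leqnn d).
(* For this [D] one has (B D + 1)^n <= (B + 1)^n D^n < D^(n+1) <= D^d: more polynomials than
   monomials, although they are independent. *)
pose D := ((B + 1) ^ n).+1.
have [I [u [Icard usize uind]]] := BE D.
have [|c [j /eqP cj] cE] := mpoly_dependent usize.
  rewrite Icard; apply: leq_trans (leq_pexp2l _ lt_nd) => //.
  apply: (@leq_ltn_trans (((B + 1) * D) ^ n)).
    have [->|n_gt0] := posnP n; first by rewrite !expn0.
    by rewrite leq_exp2r // mulnDl mul1n leq_add2l.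
  by rewrite expnMn expnS ltn_pmul2r // expn_gt0.
by apply/cj/uind => t _; apply: cE.
Qed.

End AffineSpace.

(** * Tangent spaces of affine space *)

Section TangentAffine.
Variables (K : closedFieldType) (A : finType).
Local Notation n := #|A|.
Local Notation AA := (affine_space K A).
Implicit Types (t : AA) (P Q : {mpoly K[n]}) (f g : AA -> K).

Lemma near_eqW (U : set AA) t f g : opn U -> U t ->
  (forall s, U s -> f s = g s) -> near_eq t f g.
Proof. by move=> oU Ut fg; exists U. Qed.

Lemma near_eq2 t f g f' g' : near_eq t f g -> near_eq t f' g' ->
  exists U : set AA, [/\ opn U, U t, forall s, U s -> f s = g s &
                         forall s, U s -> f' s = g' s].
Proof.
move=> [U [oU Ut fg]] [V [oV Vt fg']]; exists (U `&` V); split=> //.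
- exact: (opnI (affine_space_sheaf K A)).
- by move=> s [/fg].
- by move=> s [_ /fg'].
Qed.

Lemma near_eq_sym t f g : near_eq t f g -> near_eq t g f.
Proof. by move=> [U [oU Ut fg]]; exists U; split=> // s /fg. Qed.

Lemma near_eq_trans t f g h : near_eq t f g -> near_eq t g h -> near_eq t f h.
Proof.
move=> fg gh; have [U [oU Ut E E']] := near_eq2 fg gh.
by apply: (near_eqW oU Ut) => s Us; rewrite E // E'.
Qed.

(** The fraction P / Q represents the germ of [f] at [t]. *)
Definition germ t f P Q : Prop :=
  aeval Q t != 0 /\ near_eq t f (fun s => aeval P s / aeval Q s).

Lemma reg_at_germ t f : reg_at t f -> exists P Q, germ t f P Q.
Proof.
move=> [U [oU Ut rf]].
have [F [G [[P [Q [/funext-> /funext->]]] Qt fE]]] := rf t Ut.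
exists P, Q; split=> //; exists (U `&` [set s | aeval Q s != 0]); split=> //.
  by apply: (opnI (affine_space_sheaf K A)) => //; apply: opn_aeval.
by move=> s [Us Qs]; apply: fE.
Qed.

Lemma reg_at_aeval t P : reg_at t (aeval P).
Proof.
exists setT; split=> //; first exact: (opn_setT (affine_space_sheaf K A)).
apply: (reg_meval (affine_space_sheaf K A)) => i.
exact: (@reg_coord K A (enum_val i)).
Qed.

Lemma germ_value t f P Q : germ t f P Q -> f t = aeval P t / aeval Q t.
Proof. by move=> [_ [U [_ Ut]]]; apply. Qed.

Lemma germ_eq t f g P Q : near_eq t f g -> germ t f P Q -> germ t g P Q.
Proof.
by move=> fg [Qt fPQ]; split=> //; apply: near_eq_trans fPQ; apply: near_eq_sym.
Qed.

Lemma germ_aeval t P : germ t (aeval P) P 1.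
Proof.
split; first by rewrite aeval1 oner_neq0.
apply: (@near_eqW setT) => //; first exact: (opn_setT (affine_space_sheaf K A)).
by move=> s _; rewrite aeval1 divr1.
Qed.

Lemma germ_linear t f g P Q P' Q' (a : K) : germ t f P Q -> germ t g P' Q' ->
  germ t (fun s => a * f s + g s) (a%:MP * (P * Q') + P' * Q) (Q * Q').
Proof.
move=> [Qt fE] [Q't gE]; split; first by rewrite aevalM mulf_neq0.
have [U [oU Ut E E']] := near_eq2 fE gE.
exists (U `&` [set s | aeval (Q * Q') s != 0]); split.
- by apply: (opnI (affine_space_sheaf K A)) => //; apply: opn_aeval.
- by split; rewrite //= aevalM mulf_neq0.
- move=> s [Us /=]; rewrite E // E' // !(aevalD, aevalM, aevalC).
  rewrite mulf_eq0 negb_or => /andP[Qs Q's].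
  by field; rewrite Qs Q's.
Qed.

Lemma germM t f g P Q P' Q' : germ t f P Q -> germ t g P' Q' ->
  germ t (fun s => f s * g s) (P * P') (Q * Q').
Proof.
move=> [Qt fE] [Q't gE]; split; first by rewrite aevalM mulf_neq0.
have [U [oU Ut E E']] := near_eq2 fE gE.
by apply: (near_eqW oU Ut) => s Us; rewrite E // E' // !aevalM mulf_div.
Qed.

Lemma mderiv_near0 t P i : near_eq t (aeval P) (fun=> 0) -> aeval P^`M(i) t = 0.
Proof.
move=> [U [oU Ut P0]]; have [G Gt GU] := opn_affine oU Ut.
have [L [LE <-]] := aeval_line P t i; have [M [ME _]] := aeval_line G t i.
suff -> : L = 0 by rewrite deriv0 horner0.
(* On the line, [G] vanishes wherever [P] does not, so L M vanishes everywhere; and M.[0] is [G] at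
   [t], which is nonzero. *)
have : L * M = 0.
  apply: poly_horner_eq0 => s; rewrite hornerM LE ME.
  have [->|/GU/P0->] := eqVneq (aeval G (line t [ffun a => (a == enum_val i)%:R] s)) 0.
    by rewrite mulr0.
  by rewrite mul0r.
move/eqP; rewrite mulf_eq0 => /orP[/eqP//|/eqP M0].
by move: Gt; rewrite -[t](line0 t [ffun a => (a == enum_val i)%:R]) -ME M0 horner0 eqxx.
Qed.

Definition quotient_deriv i P Q t : K :=
  (aeval P^`M(i) t * aeval Q t - aeval P t * aeval Q^`M(i) t) / aeval Q t ^+ 2.

(** If P / Q and P' / Q' agree near [t], then P Q' - P' Q vanishes near [t], and so do its partial
    derivatives at [t]; with equal values at [t] this gives equal quotient rules. *)
Lemma quotient_deriv_germ i t f P Q P' Q' : germ t f P Q -> germ t f P' Q' ->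
  quotient_deriv i P Q t = quotient_deriv i P' Q' t.
Proof.
move=> gf gf'; have [Qt fE] := gf; have [Q't fE'] := gf'.
have val : aeval P t / aeval Q t = aeval P' t / aeval Q' t.
  by rewrite -(germ_value gf) (germ_value gf').
have [U [oU Ut E E']] := near_eq2 fE fE'.
have /(@mderiv_near0 _ _ i) : near_eq t (aeval (P * Q' + (-1)%:MP * (P' * Q))) (fun=> 0).
  exists (U `&` [set s | aeval (Q * Q') s != 0]); split.
  - by apply: (opnI (affine_space_sheaf K A)) => //; apply: opn_aeval.
  - by split; rewrite //= aevalM mulf_neq0.
  - move=> s [Us /=]; rewrite !(aevalD, aevalM, aevalC).
    rewrite mulf_eq0 negb_or => /andP[Qs Q's].
    have := E s Us; rewrite E' // => /(canRL (divfK Q's)) ->.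
    by field.
rewrite mderivD mderiv_mulC !mderivM !(aevalD, aevalM, aevalC) /quotient_deriv.
move: val; move/(canRL (divfK Qt)) => ->.
move: (aeval P^`M(i) t) (aeval P'^`M(i) t) (aeval Q^`M(i) t) (aeval Q'^`M(i) t).
move: (aeval P' t) (aeval Q t) (aeval Q' t) Qt Q't => p q q' q0 q0' dp dp' dq dq' E0.
have -> : dp = (p / q' * q * -1 * dq' + (dp' * q + p * dq)) / q'.
  apply: (mulIf q0'); rewrite divfK //; apply/eqP.
  by rewrite -subr_eq0 -E0; apply/eqP; ring.
by field; rewrite q0 q0'.
Qed.

(** The partial derivative through any fraction representing the germ; functions without such a
    fraction get the default 0. *)
Definition coord_deriv t (i : 'I_n) f : K :=
  xget 0 [set d | exists P Q, germ t f P Q /\ d = quotient_deriv i P Q t].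

Lemma coord_derivE t i f P Q : germ t f P Q ->
  coord_deriv t i f = quotient_deriv i P Q t.
Proof.
move=> gf; have : exists d, exists P Q, germ t f P Q /\ d = quotient_deriv i P Q t.
  by exists (quotient_deriv i P Q t), P, Q.
move=> /(xgetPex 0)[P' [Q' [gf' E]]].
by rewrite /coord_deriv E; apply: quotient_deriv_germ gf' gf.
Qed.

Lemma tangent_coord_deriv t i : tangent_vector t (coord_deriv t i).
Proof.
move=> f g /reg_at_germ[P [Q gf]] /reg_at_germ[P' [Q' gg]].
have [Qt _] := gf; have [Q't _] := gg.
split=> [fg|a|].
- by rewrite (coord_derivE i gf) (coord_derivE i (germ_eq fg gf)).
- rewrite (coord_derivE i gf) (coord_derivE i gg) (coord_derivE i (germ_linear a gf gg)).
  rewrite /quotient_deriv mderivD mderiv_mulC !mderivM !(aevalD, aevalM, aevalC).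
  by field; rewrite Qt Q't.
- rewrite (coord_derivE i gf) (coord_derivE i gg) (coord_derivE i (germM gf gg)).
  rewrite (germ_value gf) (germ_value gg).
  rewrite /quotient_deriv !mderivM !(aevalD, aevalM).
  by field; rewrite Qt Q't.
Qed.

Lemma tangent_vector_cst t D c : tangent_vector t D -> D (fun=> c) = 0.
Proof.
have r a : reg_at t (fun=> a : K).
  by have := reg_at_aeval t a%:MP; congr reg_at; apply/funext => s; rewrite aevalC.
move=> TD.
have D0 : D (fun=> 0) = 0.
  have [_ /(_ 1) + _] := TD _ _ (r 0) (r 0).
  rewrite mulr0 addr0 mul1r => /eqP.
  by rewrite -subr_eq0 opprD addrA subrr sub0r oppr_eq0 => /eqP.
have D1 : D (fun=> 1) = 0.
  have [_ _] := TD _ _ (r 1) (r 1).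
  rewrite mulr1 mul1r mulr1 => /eqP.
  by rewrite -subr_eq0 opprD addrA subrr sub0r oppr_eq0 => /eqP.
have [_ /(_ c) + _] := TD _ _ (r 1) (r 0).
by rewrite mulr1 addr0 D1 D0 mulr0 addr0.
Qed.

(** The chain rule: a tangent vector is determined on polynomials by its values on the
    coordinates. *)
Lemma tangent_vector_aeval t D P : tangent_vector t D ->
  D (aeval P) = \sum_i D (aeval 'X_i) * aeval P^`M(i) t.
Proof.
move=> TD; elim/mpoly_ring_ind: P => [c|j|P Q IHP IHQ|P Q IHP IHQ].
- have -> : aeval c%:MP = (fun=> c) :> (AA -> K).
    by apply/funext => s; rewrite aevalC.
  rewrite (tangent_vector_cst _ TD) // big1 // => i _.
  by rewrite mderivC aeval0 mulr0.
- rewrite (bigD1 j) //= big1 ?addr0 => [|i ij]; rewrite aeval_mderivX.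
    by rewrite eqxx mulr1.
  by rewrite (negPf ij) mulr0.
- have -> : aeval (P + Q) = (fun s => 1 * aeval P s + aeval Q s) :> (AA -> K).
    by apply/funext => s; rewrite mul1r aevalD.
  have [_ -> _] := TD _ _ (reg_at_aeval t P) (reg_at_aeval t Q).
  rewrite mul1r IHP IHQ -big_split; apply: eq_bigr => i _ /=.
  by rewrite mderivD aevalD mulrDr.
- have -> : aeval (P * Q) = (fun s => aeval P s * aeval Q s) :> (AA -> K).
    by apply/funext => s; rewrite aevalM.
  have [_ _ ->] := TD _ _ (reg_at_aeval t P) (reg_at_aeval t Q).
  rewrite IHP IHQ mulr_sumr mulr_suml -big_split; apply: eq_bigr => i _ /=.
  by rewrite mderivM aevalD !aevalM; ring.
Qed.

(** Apply the Leibniz rule to f Q = P, which holds near [t]. *)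
Lemma tangent_vector_germ t D f P Q : tangent_vector t D -> reg_at t f ->
  germ t f P Q -> D f = (D (aeval P) - f t * D (aeval Q)) / aeval Q t.
Proof.
move=> TD rf gf; have [Qt fE] := gf.
have rQ := reg_at_aeval t Q; have rP := reg_at_aeval t P.
have [_ _ DM] := TD _ _ rf rQ.
have rfQ : reg_at t (fun s => f s * aeval Q s).
  have [U [oU Ut rU]] := rf; have [V [oV Vt rV]] := rQ.
  have shA := affine_space_sheaf K A.
  exists (U `&` V); split=> //; first exact: (opnI shA).
  by apply: (regM shA); [apply: (reg_sub shA oU rU)|apply: (reg_sub shA oV rV)];
    move=> s [].
have [DE _ _] := TD _ _ rfQ rP.
have {}DE : D (fun s => f s * aeval Q s) = D (aeval P).
  apply: DE; have [U [oU Ut E]] := fE.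
  exists (U `&` [set s | aeval Q s != 0]); split=> //.
    by apply: (opnI (affine_space_sheaf K A)) => //; apply: opn_aeval.
  by move=> s [Us Qs]; rewrite E // divfK.
by rewrite -DE DM addrAC subrr add0r mulfK.
Qed.

Lemma tangent_dimension_affine_space t : tangent_dimension t n.
Proof.
exists (coord_deriv t); split; first exact: tangent_coord_deriv.
move=> D TD; exists (\row_i D (aeval 'X_i)); split.
  move=> f rf; have [P [Q gf]] := reg_at_germ rf; have [Qt _] := gf.
  rewrite (tangent_vector_germ TD rf gf) (germ_value gf).
  rewrite (tangent_vector_aeval P TD) (tangent_vector_aeval Q TD).
  rewrite mulr_sumr -sumrB mulr_suml; apply: eq_bigr => i _.
  by rewrite mxE (coord_derivE i gf) /quotient_deriv; field.
move=> a aE; apply/rowP => j; rewrite mxE (aE _ (reg_at_aeval t 'X_j)).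
have E i : coord_deriv t i (aeval 'X_j) = (i == j)%:R.
  rewrite (coord_derivE _ (germ_aeval t 'X_j)) /quotient_deriv aeval_mderivX.
  by rewrite -[X in X^`M(i)]mpolyC1 mderivC aeval0 aeval1 mulr0 subr0 expr1n divr1 mulr1.
rewrite (bigD1 j) //= big1 ?addr0 => [|i ij].
  by rewrite E eqxx mulr1.
by rewrite E (negPf ij) mulr0.
Qed.

End TangentAffine.

(** * Charts of Fbar *)

Section FbarCharts.
Variables (K : closedFieldType) (n : nat).
Local Notation FF := (FbarS K n).
Local Notation ix := 'I_n.+1.
Implicit Types (c : {ffun pairs n -> P1 K}) (i j k : ix) (p q r : pairs n).

Lemma subspace_eq (Y : space K) (S : set Y) (x y : subspace S) :
  sval x = sval y -> x = y.
Proof. by case: x y => [x Sx] [y Sy] /= E; subst; apply: eq_exist. Qed.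

Lemma FbarS_sheaf : function_sheaf FF.
Proof. exact: subspace_sheaf (P1pow_sheaf _ _) _. Qed.

Lemma Fbar_closed : opn (~` @Fbar K n).
Proof.
move=> c /existsNP[p /existsNP[q /existsNP[r /not_implyP[pq /not_implyP[pr]]]]].
move=> /not_implyP[qr neq].
pose F : {mpoly K[#|{: pairs n * bool}|]} := hvar K p false * hvar K q true * hvar K r false
  - hvar K p true * hvar K q false * hvar K r true.
have FE (d : {ffun pairs n -> P1 K}) : heval F d =
  (hc (d p)).1 * (hc (d q)).2 * (hc (d r)).1 -
  (hc (d p)).2 * (hc (d q)).1 * (hc (d r)).2.
  by rewrite hevalD hevalN !hevalM !heval_hvar.
(* Both monomials have degree one in each of the coordinate pairs at p, q and r. *)
have hF : multihomogeneous
    (fun s => (s == p) + (s == q) + (s == r))%N F.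
  have h3 b b' b'' := multihomogeneousM (multihomogeneousM
    (@multihomogeneous_hvar K _ p b) (@multihomogeneous_hvar K _ q b'))
    (@multihomogeneous_hvar K _ r b'').
  by apply: multihomogeneousD; [|apply: multihomogeneousN]; apply: h3.
exists (heval F), (heval F); split.
- by exists (fun s => (s == p) + (s == q) + (s == r))%N, F, F.
- by rewrite FE subr_eq0; apply/eqP.
- move=> d; rewrite FE subr_eq0 => /eqP dN Fd; apply: dN.
  exact: Fd.
Qed.

Definition pair_of i j : option (pairs n) := insub (i, j).

Variant pair_of_spec i j : option (pairs n) -> Type :=
  | PairOf p of val p = (i, j) & (3 <= i)%N & (i < j)%N :
      pair_of_spec i j (Some p)
  | NoPairOf of ~~ ((3 <= i) && (i < j))%N : pair_of_spec i j None.

Lemma pair_ofP i j : pair_of_spec i j (pair_of i j).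
Proof.
rewrite /pair_of; case: insubP => [p /andP[i3 ij] pE|]; first exact: PairOf.
exact: NoPairOf.
Qed.

(* The coordinates (c_ij : c'_ij) extended to all i and j by the rules        *)
(* c_ji = c'_ij and c_ii = c'_ii.                                             *)
Definition crd c i j : K * K :=
  if pair_of i j is Some p then hc (c p)
  else if pair_of j i is Some p then ((hc (c p)).2, (hc (c p)).1)
  else (1, 1).

Lemma crd_pair c p : crd c (val p).1 (val p).2 = hc (c p).
Proof. by rewrite /crd /pair_of -surjective_pairing valK. Qed.

Lemma crd_swap c i j : crd c j i = ((crd c i j).2, (crd c i j).1).
Proof.
rewrite /crd; case: pair_ofP => [p _ _ ji|_]; case: pair_ofP => [q _ _ ij|_] //.
  by have := ltn_trans ij ji; rewrite ltnn.
by rewrite -surjective_pairing.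
Qed.

Lemma crd_id c i : crd c i i = (1, 1).
Proof. by rewrite /crd; case: pair_ofP => // p _ _; rewrite ltnn. Qed.

Lemma crd_neq0 c i j : ((crd c i j).1, (crd c i j).2) != (0, 0).
Proof.
rewrite /crd; case: pair_ofP => [p _ _ _|_]; first exact: hc_pair_neq0.
case: pair_ofP => [p _ _ _|_] /=.
  by have := hc_pair_neq0 (c p); rewrite !xpair_eqE andbC.
by rewrite xpair_eqE oner_eq0.
Qed.

Lemma pair_intro i j : (3 <= i)%N -> (i < j)%N ->
  exists p : pairs n, val p = (i, j).
Proof.
move=> i3 ij; have H : (3 <= (i, j).1)%N && ((i, j).1 < (i, j).2)%N by rewrite i3.
by exists (Sub (i, j) H).
Qed.

Lemma crd_cocycle c i j k : @Fbar K n c ->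
  (3 <= i)%N -> (3 <= j)%N -> (3 <= k)%N ->
  (crd c i j).1 * (crd c i k).2 * (crd c j k).1 =
  (crd c i j).2 * (crd c i k).1 * (crd c j k).2.
Proof.
move=> Fc.
pose C i j k := (crd c i j).1 * (crd c i k).2 * (crd c j k).1 =
  (crd c i j).2 * (crd c i k).1 * (crd c j k).2.
(* The relation is symmetric in the three indices: [s1] and [s2] are transpositions, so it suffices
   to treat increasing triples, where equal indices make it trivial. *)
have base (a b d : ix) : (3 <= a)%N -> (a <= b)%N -> (b <= d)%N -> C a b d.
  move=> a3; rewrite leq_eqVlt => /orP[/eqP/val_inj <-|ab].
    by move=> _; rewrite /C crd_id /= !mul1r mulrC.
  rewrite leq_eqVlt => /orP[/eqP/val_inj <-|bd].
    by rewrite /C crd_id /= !mulr1 mulrC.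
  have b3 : (3 <= b)%N by apply: leq_trans a3 (ltnW ab).
  have [p pE] := pair_intro a3 ab; have [q qE] := pair_intro a3 (ltn_trans ab bd).
  have [r rE] := pair_intro b3 bd.
  have := Fc p q r; rewrite /C -!crd_pair pE qE rE /=; exact.
have s1 (a b d : ix) : C a b d -> C b a d.
  rewrite /C (crd_swap c a b) /= => E.
  by rewrite -mulrA [X in _ * X]mulrC mulrA -E; ring.
have s2 (a b d : ix) : C a b d -> C a d b.
  rewrite /C (crd_swap c b d) /= => E.
  transitivity ((crd c a b).2 * (crd c a d).1 * (crd c b d).2); first by ring.
  by rewrite -E; ring.
move=> i3 j3 k3; rewrite -/(C i j k).
have [ij|/ltnW ji] := leqP i j; have [jk|/ltnW kj] := leqP j k;
  have [ik|/ltnW ki] := leqP i k.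
- exact: base.
- exact: base.
- by apply/s2/base.
- by apply/s2/s1/base.
- by apply/s1/base.
- by apply/s1/s2/base.
- by apply/s2/s1/s2/base.
- by apply/s2/s1/s2/base.
Qed.

Lemma crd_morphism i j (b : bool) :
  opn [set c : P1pow K (pairs n) |
        (if b then (crd c i j).2 else (crd c i j).1) != 0] /\
  reg [set c : P1pow K (pairs n) |
        (if b then (crd c i j).2 else (crd c i j).1) != 0]
    (fun c => (if b then (crd c i j).1 else (crd c i j).2) /
              (if b then (crd c i j).2 else (crd c i j).1)).
Proof.
have shP := P1pow_sheaf K (pairs n).
rewrite /crd; case: pair_ofP => [p _ _ _|_].
  by split; [exact: (@opn_hc_neq0 K _ p b)|exact: (@reg_hc_ratio K _ p b)].
case: pair_ofP => [p _ _ _|_].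
  have := @opn_hc_neq0 K _ p (~~ b); have := @reg_hc_ratio K _ p (~~ b).
  by case: b.
split; last by case: b; apply: reg_ext (reg_cst shP _ 1) => c; rewrite divr1.
have := opn_setT shP; congr opn; apply/seteqP.
by split=> c _ //=; case: b; exact: oner_neq0.
Qed.

(** The point with x_ij = g i j / g j i. Chart points, the torus orbit and cross ratios are all
    given in this form, with g as below making it a point of the variety. *)
Definition skew_pt (g : ix -> ix -> K) : {ffun pairs n -> P1 K} :=
  [ffun p => hpt (g (val p).1 (val p).2) (g (val p).2 (val p).1)].

Definition skew_cocycle (g : ix -> ix -> K) :=
  (forall i j, (3 <= i < j)%N -> (g i j, g j i) != (0, 0)) /\
  (forall i j k, (3 <= i < j)%N -> (j < k)%N ->
    g i j * g k i * g j k = g j i * g i k * g k j).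

Lemma crd_skew_pt g i j : skew_cocycle g -> (3 <= i)%N -> (3 <= j)%N -> i != j ->
  exists2 l : K, l != 0 & crd (skew_pt g) i j = (l * g i j, l * g j i).
Proof.
move=> [g0 _] i3 j3 nij.
have H (a b : ix) : (3 <= a)%N -> (a < b)%N ->
    exists2 l : K, l != 0 & crd (skew_pt g) a b = (l * g a b, l * g b a).
  move=> a3 ab; have [p pE] := pair_intro a3 ab.
  have := crd_pair (skew_pt g) p; rewrite /skew_pt ffunE pE /= => ->.
  by apply: hc_hpt; apply: g0; rewrite a3.
have [ij|ji|/val_inj E] := ltngtP i j; first exact: H.
  have [l l0 lE] := H j i j3 ji; exists l => //.
  by rewrite crd_swap lE.
by rewrite E eqxx in nij.
Qed.

Lemma Fbar_skew_pt g : skew_cocycle g -> @Fbar K n (skew_pt g).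
Proof.
move=> gc; have [g0 gE] := gc => p q r pq pr qr.
have [p1 q1 r1 q2] : [/\ (val p).1 = (val q).1, (val r).1 = (val p).2,
  (val r).2 = (val q).2 & True] by rewrite -pr.
have /andP[p3 pp] := valP p; have /andP[r3 rr] := valP r.
have /andP[q3 qq] := valP q.
have H s : exists2 l : K, l != 0 & hc (skew_pt g s) =
    (l * g (val s).1 (val s).2, l * g (val s).2 (val s).1).
  by rewrite /skew_pt ffunE; apply: hc_hpt; apply: g0; apply: (valP s).
have [l l0 ->] := H p; have [l' l'0 ->] := H q; have [l'' l''0 ->] := H r.
have := gE (val p).1 (val p).2 (val r).2; rewrite p3 pp -{1}q1 => /(_ isT rr).
rewrite /= q1 r1 p1 => E.
transitivity (l * l' * l'' * (g (val q).1 (val p).2 * g (val q).2 (val q).1 *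
  g (val p).2 (val q).2)); first by ring.
by rewrite E; ring.
Qed.

Definition skew_Fbar g (gc : skew_cocycle g) : FF :=
  exist _ (skew_pt g) (Fbar_skew_pt gc).

(** * The chart attached to an ordering of the indices *)

Section OneChart.
Variable s : seq ix.
Hypothesis s_ge3 : forall i, (i \in s) = (3 <= i)%N.
Hypothesis s_uniq : uniq s.
Hypothesis s_size : size s = (n - 3).+1.
Local Notation AA := (affine_space K 'I_(n - 3)).

(** The value of x_ij for the k-th and next index in [s]; out of range it is the neutral factor
    1. *)
Definition gap (y : {ffun 'I_(n - 3) -> K}) (k : nat) : K :=
  if insub k is Some o then y o else 1.

(** The product is empty, hence 1, unless [i] precedes [j] in [s]. So one of gap_prod y i j and
    gap_prod y j i is always 1, and their ratio is a legitimate point of the projective line. *)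
Definition gap_prod y i j : K := \prod_(index i s <= k < index j s) gap y k.

Lemma gap_prod_ge y i j : (index j s <= index i s)%N -> gap_prod y i j = 1.
Proof. by move=> ji; rewrite /gap_prod big_geq. Qed.

Lemma gap_prod_cat y i j k : (index i s <= index j s)%N -> (index j s <= index k s)%N ->
  gap_prod y i k = gap_prod y i j * gap_prod y j k.
Proof. by move=> ij jk; rewrite /gap_prod -big_cat_nat. Qed.

Lemma gap_prod_cocycle y : skew_cocycle (gap_prod y).
Proof.
split=> [i j _|i j k _ _].
  have [ij|/ltnW ji] := leqP (index i s) (index j s); rewrite xpair_eqE.
    by rewrite [X in _ && (X == _)]gap_prod_ge // oner_eq0 andbF.
  by rewrite gap_prod_ge // oner_eq0.
have [ij|/ltnW ij] := leqP (index i s) (index j s);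
have [jk|/ltnW jk] := leqP (index j s) (index k s);
have [ik|/ltnW ik] := leqP (index i s) (index k s).
- rewrite (gap_prod_cat y ij jk) (gap_prod_ge y ij) (gap_prod_ge y jk) (gap_prod_ge y ik).
  by ring.
- have E : index i s = index k s by apply/eqP; rewrite eqn_leq ik (leq_trans ij jk).
  by rewrite /gap_prod E; ring.
- rewrite (gap_prod_cat y ik jk) (gap_prod_ge y ij) (gap_prod_ge y jk) (gap_prod_ge y ik).
  by ring.
- rewrite (gap_prod_cat y ik ij) (gap_prod_ge y ij) (gap_prod_ge y jk) (gap_prod_ge y ik).
  by ring.
- rewrite (gap_prod_cat y ij ik) (gap_prod_ge y ij) (gap_prod_ge y jk) (gap_prod_ge y ik).
  by ring.
- rewrite (gap_prod_cat y jk ik) (gap_prod_ge y ij) (gap_prod_ge y jk) (gap_prod_ge y ik).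
  by ring.
- have E : index i s = index k s.
    by apply/eqP; rewrite eqn_leq ik (leq_trans jk ij).
  by rewrite /gap_prod E; ring.
- rewrite (gap_prod_cat y jk ij) (gap_prod_ge y ij) (gap_prod_ge y jk) (gap_prod_ge y ik).
  by ring.
Qed.

Definition chart_map (y : AA) : FF := skew_Fbar (gap_prod_cocycle y).

Local Notation "s`_ k" := (nth ord0 s k) (at level 3, k at level 2, format "s`_ k").

Definition chart_inv (c : FF) : AA :=
  [ffun k : 'I_(n - 3) => (crd (sval c) s`_k s`_k.+1).1 /
                          (crd (sval c) s`_k s`_k.+1).2].

Lemma nth_ge3 (k : nat) : (k < (n - 3).+1)%N -> (3 <= s`_k)%N.
Proof. by move=> kn; rewrite -s_ge3 mem_nth // s_size. Qed.

Lemma index_nth (k : nat) : (k < (n - 3).+1)%N -> index s`_k s = k.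
Proof. by move=> kn; rewrite index_uniq // s_size. Qed.

Lemma crd_chart_map y (k : 'I_(n - 3)) : exists2 l : K, l != 0 &
  crd (sval (chart_map y)) s`_k s`_k.+1 = (l * (y : {ffun _}) k, l).
Proof.
have k1 : (k < (n - 3).+1)%N by rewrite ltnS ltnW.
have k2 : (k.+1 < (n - 3).+1)%N by rewrite ltnS.
have [|l l0 lE] := crd_skew_pt (gap_prod_cocycle y) (nth_ge3 k1) (nth_ge3 k2).
  by rewrite nth_uniq ?s_size // neq_ltn leqnn.
exists l => //; rewrite lE [gap_prod y s`_k.+1 _]gap_prod_ge ?mulr1 ?index_nth //.
by rewrite /gap_prod !index_nth // big_nat1 /gap valK.
Qed.

Lemma chart_mapK : cancel chart_map chart_inv.
Proof.
move=> y; apply/ffunP => k; rewrite ffunE.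
by have [l l0 ->] := crd_chart_map y k; rewrite /= mulrAC divff // mul1r.
Qed.

Lemma chart_inv_prod (c : FF) a b :
  (forall k : 'I_(n - 3), (crd (sval c) s`_k s`_k.+1).2 != 0) ->
  (a <= b)%N -> (b < (n - 3).+1)%N ->
  (crd (sval c) s`_a s`_b).2 != 0 /\
  (crd (sval c) s`_a s`_b).1 =
  (crd (sval c) s`_a s`_b).2 * \prod_(a <= k < b) gap (chart_inv c) k.
Proof.
move=> nz; elim: b => [|b IHb].
  rewrite leqn0 => /eqP-> _; rewrite crd_id big_geq //= mulr1.
  by split=> //; exact: oner_neq0.
rewrite leq_eqVlt => /orP[/eqP-> _|]; first rewrite crd_id big_geq //= mulr1.
  by split=> //; exact: oner_neq0.
rewrite ltnS => ab bn; have bn' := ltnW bn.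
have [ab2 ab1] := IHb ab bn'.
have bb2 := nz (Ordinal (bn : (b < n - 3)%N)).
have gE : gap (chart_inv c) b = (crd (sval c) s`_b s`_b.+1).1 /
    (crd (sval c) s`_b s`_b.+1).2 by rewrite /gap insubT ffunE.
have := crd_neq0 (sval c) s`_a s`_b.+1.
have := crd_cocycle (svalP c) (nth_ge3 (leq_ltn_trans ab bn')) (nth_ge3 bn') (nth_ge3 bn).
rewrite big_nat_recr //= gE.
move: ab1 ab2 bb2 => /=; move: (crd _ s`_a s`_b) (crd _ s`_b s`_b.+1) (crd _ s`_a s`_b.+1).
move=> [u1 u2] [v1 v2] [w1 w2] /= -> u0 v0; set P := \prod_(_ <= _ < _) _ => E w0.
(* Cancelling nonzero denominators in the cocycle relation for s_a, s_b, s_(b+1). Now w2 = 0 would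
   force w1 = 0 too, which homogeneous coordinates exclude. *)
have {}E : w1 = w2 * (P * (v1 / v2)).
  apply: (mulfI (mulf_neq0 u0 v0)); transitivity (u2 * w1 * v2); first by ring.
  by rewrite -E; field.
split=> //; apply: contraNneq w0 => w20; rewrite E w20 mul0r //.
Qed.

Lemma range_chart_map (c : FF) : range chart_map c <->
  forall k : 'I_(n - 3), (crd (sval c) s`_k s`_k.+1).2 != 0.
Proof.
split=> [[y _ <-] k|nz]; first by have [l l0 ->] := crd_chart_map y k.
exists (chart_inv c) => //; apply: subspace_eq; apply/ffunP => p.
rewrite /= /skew_pt ffunE; apply/esym/eq_hpt.
  by have [+ _] := gap_prod_cocycle (chart_inv c); apply; apply: (valP p).
rewrite -crd_pair; have /andP[i3 ij] := valP p.
move: (val p).1 (val p).2 i3 ij => i j i3 ij.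
have si : i \in s by rewrite s_ge3.
have sj : j \in s by rewrite s_ge3 (leq_trans i3) // ltnW.
have ii : (index i s < (n - 3).+1)%N by rewrite -s_size index_mem.
have jj : (index j s < (n - 3).+1)%N by rewrite -s_size index_mem.
have [ij'|/ltnW ji'] := leqP (index i s) (index j s).
  have [_] := chart_inv_prod nz ij' jj; rewrite !nth_index // => ->.
  by rewrite [gap_prod _ j i]gap_prod_ge // mulr1.
have [_] := chart_inv_prod nz ji' ii; rewrite !nth_index // crd_swap /= => ->.
by rewrite [gap_prod _ i j]gap_prod_ge // mulr1.
Qed.

Lemma reg_gap (k : nat) : reg [set: AA] (fun y => gap y k).
Proof.
rewrite /gap; case: insubP => [o _ _|_]; first exact: (@reg_coord K _ o).
exact: reg_cst (affine_space_sheaf _ _) _ _.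
Qed.

Lemma chart_chart_map : chart chart_map chart_inv.
Proof.
have shA := affine_space_sheaf K 'I_(n - 3); have shF := FbarS_sheaf.
have shP := P1pow_sheaf K (pairs n).
have oR : opn (range chart_map).
  apply: (opn_local shF) => c /range_chart_map nz.
  have [|V [oV Vc VE]] := @opn_bigI _ _ shF _ (fun k : 'I_(n - 3) =>
      [set c : FF | (crd (sval c) s`_k s`_k.+1).2 != 0]) c.
    move=> k; split; last exact: nz.
    have [o _] := crd_morphism s`_k s`_k.+1 true.
    by exists [set c : P1pow K (pairs n) | (crd c s`_k s`_k.+1).2 != 0].
  by exists V; split=> // d Vd; apply/range_chart_map => k; apply: VE.
split=> //; last 1 first.
- apply: morphism_affine; first exact: subspace_sheaf.
  move=> k; have [o r] := crd_morphism s`_k s`_k.+1 true.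
  have := (morphism_comp (@morphism_sval _ FF (range chart_map))
    (@morphism_sval _ (P1pow K (pairs n)) (@Fbar K n)) o).2 _ r.
  set U := _ @^-1` _; have -> : U = setT.
    by apply/seteqP; split=> // -[c Rc] _; have /range_chart_map := Rc; apply.
  by apply: reg_ext => c /=; rewrite ffunE.
- apply: morphism_subspace => //=; apply: morphism_P1pow => // p y.
  have ru i j : reg [set: AA] (fun y => gap_prod y i j).
    by apply: (reg_prod shA) => k _; apply: reg_gap.
  exists setT, (fun y => gap_prod y (val p).1 (val p).2),
    (fun y => gap_prod y (val p).2 (val p).1).
  split=> // [|z _]; first exact: opn_setT.
  split; last by rewrite /skew_pt ffunE.
  by have [+ _] := gap_prod_cocycle z; apply; apply: (valP p).
- exact: chart_mapK.
Qed.

End OneChart.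

Hypothesis n_gt2 : (2 < n)%N.

Lemma one_cocycle : skew_cocycle (fun _ _ => 1).
Proof. by split=> // i j _; rewrite xpair_eqE oner_eq0. Qed.

(** The point with all x_ij = 1, common to all charts and origin of the open orbit. *)
Definition base_point : FF := skew_Fbar one_cocycle.

Lemma Fbar_atlas (c : FF) : exists phi psi,
  [/\ chart (phi : affine_space K 'I_(n - 3) -> FF) psi, range phi c &
      range phi base_point].
Proof.
pose geq i j := (crd (sval c) i j).2 != 0.
pose L := [seq i : 'I_n.+1 <- enum 'I_n.+1 | (3 <= i)%N].
pose s := sort geq L.
have s3 i : (i \in s) = (3 <= i)%N by rewrite mem_sort mem_filter mem_enum andbT.
have su : uniq s by rewrite sort_uniq filter_uniq // enum_uniq.
have ss : size s = (n - 3).+1.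
  rewrite size_sort size_filter.
  have vE : map (@nat_of_ord n.+1) (enum 'I_n.+1) = iota 0 n.+1 := val_enum_ord _.
  have := count_map (@nat_of_ord n.+1) (fun i : nat => 3 <= i)%N (enum 'I_n.+1).
  rewrite vE => <-.
  (* Of the indices 0, ..., n exactly 0, 1 and 2 are discarded. *)
  have -> : n.+1 = (3 + (n - 3).+1)%N by rewrite addnS subnKC.
  rewrite iotaD count_cat /= add0n.
  rewrite (eq_in_count (a2 := predT)) ?count_predT ?size_iota //.
  by move=> i; rewrite mem_iota => /andP[i3 _]; rewrite /= (leq_trans _ i3).
(* The order is total since c_ij and c'_ij do not both vanish. Sortedness says that successive
   ratios are finite, which is the condition for lying in the chart. *)
have sorted_s : sorted geq s.
  apply: sort_sorted => i j; rewrite /geq [crd _ j i]crd_swap /=.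
  by have := crd_neq0 (sval c) i j; rewrite xpair_eqE negb_and orbC.
exists (chart_map s), (chart_inv s); split.
- exact: chart_chart_map.
- apply/(range_chart_map s3 su ss) => k.
  by move/(sortedP ord0): sorted_s; apply; rewrite ss ltnS.
- apply/(range_chart_map s3 su ss) => k.
  have k1 : (k < (n - 3).+1)%N by rewrite ltnS ltnW.
  have k2 : (k.+1 < (n - 3).+1)%N by rewrite ltnS.
  have [|l l0 ->] := crd_skew_pt one_cocycle (nth_ge3 s3 ss k1) (nth_ge3 s3 ss k2).
    by rewrite nth_uniq ?ss // neq_ltn leqnn.
  by rewrite mulr1.
Qed.

Lemma Fbar_irreducible : irreducible FF.
Proof. exact: irreducible_atlas (irreducible_affine_space K _) Fbar_atlas. Qed.

Lemma Fbar_smooth : smooth FF.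
Proof.
apply: (smooth_atlas FbarS_sheaf _ base_point
          (dimension_affine_space K 'I_(n - 3))
          (@tangent_dimension_affine_space K 'I_(n - 3))).
by move=> c; have [phi [psi [ch Rc _]]] := Fbar_atlas c; exists phi, psi.
Qed.

End FbarCharts.

(** * The torus action *)

Section TorusAction.
Variables (K : closedFieldType) (n : nat).
Local Notation FF := (FbarS K n).
Local Notation TT := (torus K 'I_(n - 3)).
Local Notation act := (@act_Fbar K n).
Implicit Types (s t : TT) (x : FF) (p : pairs n) (i j : 'I_n.+1).

Lemma torus_sheaf (A : finType) : function_sheaf (torus K A).
Proof. exact: subspace_sheaf (affine_space_sheaf _ _) _. Qed.

Lemma reg_torus_coord (A : finType) (a : A) :
  reg [set: torus K A] (fun t : torus K A => (sval t : {ffun A -> K}) a).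
Proof.
have [_ r] := @morphism_sval _ (affine_space K A)
  [set f : affine_space K A | forall a, (f : {ffun A -> K}) a != 0] setT
  (opn_setT (affine_space_sheaf K A)).
exact: r (reg_coord a).
Qed.

Lemma reg_tcoord k : reg [set: TT] (fun t => tcoord t k).
Proof.
rewrite /tcoord; case: insubP => [o _ _|_]; first exact: reg_torus_coord.
exact: reg_cst (torus_sheaf _) _ _.
Qed.

Lemma reg_rho p : reg [set: TT] (fun t => rho t p).
Proof.
rewrite /rho; case: eqP => _; first exact: reg_tcoord.
apply: (regM (torus_sheaf _)); first exact: reg_tcoord.
by apply: (regV (torus_sheaf _)) => [|t _]; [exact: reg_tcoord|exact: tcoord_neq0].
Qed.

Lemma rho_pair_neq0 t x p :
  (rho t p * (hc (sval x p)).1, (hc (sval x p)).2) != (0, 0).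
Proof.
rewrite xpair_eqE mulf_eq0 (negPf (rho_neq0 t p)) /=.
by have := hc_pair_neq0 (sval x p); rewrite xpair_eqE.
Qed.

Lemma sval_act t x p : sval (act t x) p =
  hpt (rho t p * (hc (sval x p)).1) (hc (sval x p)).2.
Proof. by rewrite /= ffunE. Qed.

Lemma tcoord_one k : tcoord (torus_one 'I_(n - 3) : TT) k = 1.
Proof. by rewrite /tcoord; case: insubP => [o _ _|_] //; rewrite /= ffunE. Qed.

Lemma tcoord_mul s t k : tcoord (torus_mul s t) k = tcoord s k * tcoord t k.
Proof.
by rewrite /tcoord; case: insubP => [o _ _|_]; rewrite /= ?ffunE ?mulr1.
Qed.

Lemma act_one x : act (torus_one _) x = x.
Proof.
apply: subspace_eq; apply/ffunP => p; rewrite sval_act.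
have -> : rho (torus_one _ : TT) p = 1.
  by rewrite /rho !tcoord_one; case: eqP => _ //; rewrite divr1.
by rewrite mul1r hpt_hc.
Qed.

Lemma act_mul s t x : act (torus_mul s t) x = act s (act t x).
Proof.
apply: subspace_eq; apply/ffunP => p; rewrite !sval_act.
apply/hpt_eq; [exact: rho_pair_neq0| |].
  by rewrite -sval_act; apply: rho_pair_neq0.
have [l l0 ->] := hc_hpt (rho_pair_neq0 t x p) => /=.
have -> : rho (torus_mul s t) p = rho s p * rho t p.
  rewrite /rho !tcoord_mul; case: eqP => _ //.
  by rewrite -mulf_div.
by ring.
Qed.

Lemma act_algebraic : algebraic_action act.
Proof.
split; [exact: act_one|exact: act_mul|].
have shT := torus_sheaf 'I_(n - 3); have shF := @FbarS_sheaf K n.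
have shTF := prod_space_sheaf shT shF.
apply: morphism_subspace => //; apply: morphism_P1pow => // p.
have m2 := morphism_comp (morphism_snd shT shF)
  (@morphism_sval _ (P1pow K (pairs n)) (@Fbar K n)).
move=> q; have [U [a [a' [oU Uq ra ra' aE]]]] := P1_regular_morphism p m2 q.
have rr : reg U (fun q : prod_space TT FF => rho q.1 p).
  have [_ r] := morphism_fst shT shF (opn_setT shT).
  by apply: (reg_sub shTF (opn_setT shTF)); first exact: r (reg_rho p).
exists U, (fun q => rho q.1 p * a q), a'; split=> //; first exact: regM.
move=> y Uy; have [a0 E] := aE y Uy.
have nz : (rho y.1 p * a y, a' y) != (0, 0).
  by move: a0; rewrite !xpair_eqE mulf_eq0 (negPf (rho_neq0 _ _)).
split=> //; rewrite sval_act; apply/hpt_eq => //; first exact: rho_pair_neq0.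
move/eq_hpt: E => /(_ a0) /= E.
by rewrite -mulrA E; ring.
Qed.

(** * The open orbit *)

Hypothesis n_ge4 : (4 <= n)%N.

Let n_gt2 : (2 < n)%N. Proof. exact: ltnW n_ge4. Qed.
Let o : FF := base_point K n.

Definition three : 'I_n.+1 := inord 3.

Lemma val_three : three = 3%N :> nat.
Proof. by rewrite inordK // ltnS. Qed.

Definition elt (k : 'I_(n - 3)) : 'I_n.+1 := inord (k + 4).

Lemma val_elt k : elt k = (k + 4)%N :> nat.
Proof. by rewrite inordK //; have := ltn_ord k; lia. Qed.

Lemma elt_ge3 k : (3 <= elt k)%N.
Proof. by rewrite val_elt; lia. Qed.

Lemma three_lt_elt k : (three < elt k)%N.
Proof. by rewrite val_three val_elt; lia. Qed.

Lemma elt_surj i : (3 <= i)%N -> i = three \/ exists k, i = elt k.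
Proof.
rewrite leq_eqVlt => /orP[/eqP i3|i4].
  by left; apply: val_inj; rewrite /= val_three.
have kP : (i - 4 < n - 3)%N by have := ltn_ord i; lia.
by right; exists (Ordinal kP); apply: val_inj; rewrite /= val_elt /=; lia.
Qed.

(** The torus coordinates completed by t_3 = 1, which gives rho_ij = w_j / w_i in all cases. *)
Definition weight t (i : nat) : K := if i == 3%N then 1 else tcoord t (i - 3).

Lemma weight_neq0 t i : weight t i != 0.
Proof. by rewrite /weight; case: ifP => _; [exact: oner_neq0|exact: tcoord_neq0]. Qed.

Lemma weight_three t : weight t three = 1.
Proof. by rewrite /weight val_three. Qed.

Lemma weight_elt t k : weight t (elt k) = (sval t : {ffun _}) k.
Proof.
rewrite /weight val_elt gtn_eqF ?addn4 // /tcoord.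
by rewrite (_ : (_ - 3).-1 = k) ?valK //; lia.
Qed.

Lemma rho_weight t p : rho t p = weight t (val p).2 / weight t (val p).1.
Proof.
have /andP[i3 ij] := valP p.
rewrite /rho /weight (gtn_eqF (leq_ltn_trans i3 ij)).
by case: eqP => // _; rewrite divr1.
Qed.

Lemma weight_cocycle t : skew_cocycle (fun _ j : 'I_n.+1 => weight t j).
Proof.
split=> [i j _|i j k _ _]; last by ring.
by rewrite xpair_eqE negb_and weight_neq0.
Qed.

Lemma act_base_point t : act t o = skew_Fbar (weight_cocycle t).
Proof.
apply: subspace_eq; apply/ffunP => p; rewrite sval_act /= /skew_pt !ffunE.
apply/hpt_eq; rewrite ?xpair_eqE ?negb_and ?weight_neq0 ?orbT //.
  have := rho_pair_neq0 t o p; rewrite /= /skew_pt ffunE.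
  by rewrite xpair_eqE negb_and.
have [|l l0 ->] := @hc_hpt K 1 1; first by rewrite xpair_eqE oner_eq0.
by rewrite /= rho_weight; field; rewrite weight_neq0.
Qed.

Definition nondegenerate x := forall k : 'I_(n - 3),
  (crd (sval x) three (elt k)).1 != 0 /\ (crd (sval x) three (elt k)).2 != 0.

(** Made total by the default [torus_one], so that the inverse of the orbit map is defined on all
    points. *)
Definition torus_of (A : finType) (f : {ffun A -> K}) : torus K A :=
  if pselect (forall a, f a != 0) is left f0 then exist _ f f0 else torus_one A.

Lemma sval_torus_of (A : finType) (f : {ffun A -> K}) :
  (forall a, f a != 0) -> sval (torus_of f) = f.
Proof. by rewrite /torus_of; case: pselect. Qed.

Definition torus_inv_map x : TT := torus_of [ffun k : 'I_(n - 3) =>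
  (crd (sval x) three (elt k)).1 / (crd (sval x) three (elt k)).2].

Lemma sval_torus_inv_map x : nondegenerate x -> forall k : 'I_(n - 3),
  (sval (torus_inv_map x) : {ffun _}) k =
  (crd (sval x) three (elt k)).1 / (crd (sval x) three (elt k)).2.
Proof.
move=> nd k; rewrite sval_torus_of ?ffunE // => l; rewrite ffunE.
by have [? ?] := nd l; rewrite mulf_neq0 ?invr_neq0.
Qed.

Lemma crd_orbit t k : exists2 l : K, l != 0 &
  crd (sval (act t o)) three (elt k) = (l * (sval t : {ffun _}) k, l).
Proof.
rewrite act_base_point.
have [||l l0 ->] := crd_skew_pt (weight_cocycle t) _ (elt_ge3 k) (_ : three != elt k).
- by rewrite val_three.
- by rewrite neq_ltn three_lt_elt.
by exists l => //; rewrite weight_elt weight_three mulr1.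
Qed.

Lemma nondegenerate_orbit t : nondegenerate (act t o).
Proof.
move=> k; have [l l0 ->] := crd_orbit t k; split=> //=.
by rewrite mulf_neq0 //; apply: (svalP t).
Qed.

Lemma torus_mapK : cancel (fun t => act t o) torus_inv_map.
Proof.
move=> t; apply: subspace_eq; apply/ffunP => k.
rewrite sval_torus_inv_map; last exact: nondegenerate_orbit.
by have [l l0 ->] := crd_orbit t k; rewrite /= mulrAC divff // mul1r.
Qed.

(** With finite nonzero x_3k, the cocycle relation gives x_ij = x_3j / x_3i, so the x_3k determine
    the point. *)
Lemma torus_inv_mapK x : nondegenerate x -> act (torus_inv_map x) o = x.
Proof.
move=> nd; rewrite act_base_point; apply: subspace_eq; apply/ffunP => p.
rewrite /= /skew_pt ffunE; apply/esym/eq_hpt.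
  by rewrite xpair_eqE negb_and weight_neq0.
rewrite -crd_pair; have /andP[i3 ij] := valP p.
move: (val p).1 (val p).2 i3 ij => i j i3 ij.
have j3 : (3 <= j)%N := leq_trans i3 (ltnW ij).
have WE (l : 'I_n.+1) : (3 <= l)%N -> (crd (sval x) three l).2 != 0 /\
    (crd (sval x) three l).1 =
    weight (torus_inv_map x) l * (crd (sval x) three l).2.
  move=> /elt_surj[->|[k ->]].
    by rewrite crd_id weight_three /= mulr1; split=> //; exact: oner_neq0.
  by have [_ ?] := nd k; rewrite weight_elt sval_torus_inv_map // divfK.
have [i0 iE] := WE i i3; have [j0 jE] := WE j j3.
have := crd_cocycle (svalP x) (_ : (3 <= three)%N) i3 j3; rewrite val_three.
move=> /(_ isT); rewrite iE jE => E.
apply: (mulfI (mulf_neq0 i0 j0)).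
transitivity (weight (torus_inv_map x) i * (crd (sval x) three i).2 *
  (crd (sval x) three j).2 * (crd (sval x) i j).1); first by ring.
by rewrite E; ring.
Qed.

Lemma range_torus x : range (fun t => act t o) x <-> nondegenerate x.
Proof.
split=> [[t _ <-]|nd]; first exact: nondegenerate_orbit.
by exists (torus_inv_map x) => //; apply: torus_inv_mapK.
Qed.

Lemma chart_torus : chart (fun t => act t o) torus_inv_map.
Proof.
have shT := torus_sheaf 'I_(n - 3); have shF := @FbarS_sheaf K n.
have shP := P1pow_sheaf K (pairs n).
split; last 1 first.
- apply: morphism_subspace; first exact: subspace_sheaf.
  apply: morphism_affine; first exact: subspace_sheaf.
  move=> k; have [o' r] := crd_morphism K three (elt k) true.
  have := (morphism_comp (@morphism_sval _ FF (range (fun t => act t o)))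
    (@morphism_sval _ (P1pow K (pairs n)) (@Fbar K n)) o').2 _ r.
  set U := _ @^-1` _; have -> : U = setT.
    by apply/seteqP; split=> // -[c Rc] _; have /range_torus/(_ k)[] := Rc.
  apply: reg_ext => -[c Rc] /=.
  by rewrite sval_torus_inv_map //; apply/range_torus.
- apply: morphism_subspace => //; apply: morphism_P1pow => // p t.
  exists setT, (fun t => rho t p * (hc (sval o p)).1), (fun=> (hc (sval o p)).2).
  split=> //; first exact: opn_setT.
  + by apply: (regM shT); [exact: reg_rho|exact: reg_cst].
  + exact: reg_cst.
  + by move=> s _; split; [exact: rho_pair_neq0|exact: sval_act].
- exact: torus_mapK.
- apply: (opn_local shF) => c /range_torus nd.
  have [|V [oV Vc VE]] := @opn_bigI _ _ shF _ (fun kb : 'I_(n - 3) * bool =>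
      [set c : FF | (if kb.2 then (crd (sval c) three (elt kb.1)).2
                     else (crd (sval c) three (elt kb.1)).1) != 0]) c.
    move=> [k b]; split; last by have [] := nd k; case: b.
    have [o' _] := crd_morphism K three (elt k) b.
    by eexists; first exact: o'.
  exists V; split=> // d Vd; apply/range_torus => k.
  by split; [apply: (VE (k, false))|apply: (VE (k, true))].
Qed.

Lemma Fbar_smooth_toric : smooth_toric_variety (S := @Fbar K n) act.
Proof.
split.
- exact: Fbar_closed.
- exact: Fbar_irreducible.
- exact: Fbar_smooth.
- exact: act_algebraic.
- by exists o; apply: (chart_open_immersion (torus_sheaf _) chart_torus).
Qed.

Lemma torus_div s t : exists r, torus_mul r t = s.
Proof.
exists (torus_of [ffun a => (sval s : {ffun _}) a / (sval t : {ffun _}) a]).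
apply: subspace_eq; apply/ffunP => a.
rewrite ffunE sval_torus_of ?ffunE ?divfK //; first exact: (svalP t).
by move=> b; rewrite ffunE mulf_neq0 ?invr_neq0 //; [apply: (svalP s)|apply: (svalP t)].
Qed.

Lemma exists_neq01 : exists2 a : K, a != 0 & a != 1.
Proof.
have /closed_nonrootP[a] : 'X * ('X - 1%:P) != 0 :> {poly K}.
  by rewrite mulf_neq0 ?polyX_eq0 ?polyXsubC_eq0.
rewrite rootM negb_or rootX root_XsubC => /andP[a0 a1].
by exists a.
Qed.

(* If x_3k is 0 or infinity, scale by some a <> 1 exactly the t_j for which   *)
(* x_3j is 0 or infinity: rho_ij is then 1 unless x_ij is 0 or infinity.      *)
Lemma general_nondegenerate x : general act x -> nondegenerate x.
Proof.
move=> gx; have [a a0 a1] := exists_neq01.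
pose nz i := ((crd (sval x) three i).1 != 0) && ((crd (sval x) three i).2 != 0).
pose t : TT := torus_of [ffun k => if nz (elt k) then 1 else a].
have t0 k : [ffun k => if nz (elt k) then 1 else a] k != 0.
  by rewrite ffunE; case: ifP => _ //; exact: oner_neq0.
have tE k : (sval t : {ffun _}) k = if nz (elt k) then 1 else a.
  by rewrite sval_torus_of // ffunE.
have wE i : (3 <= i)%N -> weight t i = if nz i then 1 else a.
  move=> /elt_surj[->|[k ->]]; last by rewrite weight_elt tE.
  by rewrite weight_three /nz crd_id /= oner_neq0.
have tx : act t x = x.
  apply: subspace_eq; apply/ffunP => p; rewrite sval_act.
  apply/esym/eq_hpt; first exact: rho_pair_neq0.
  have /andP[i3 ij] := valP p; rewrite rho_weight -crd_pair.
  move: (val p).1 (val p).2 i3 ij => i j i3 ij.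
  have j3 : (3 <= j)%N := leq_trans i3 (ltnW ij).
  have := crd_cocycle (svalP x) (_ : (3 <= three)%N) i3 j3; rewrite val_three.
  move=> /(_ isT) E; rewrite !wE //.
  (* If x_ij is neither 0 nor infinity, then x_3i x_ij = x_3j makes x_3i and x_3j degenerate
     together, and rho_ij = 1. Otherwise both sides of the equation to prove are 0. *)
  suff [->|E0] : nz i = nz j \/ (crd (sval x) i j).1 * (crd (sval x) i j).2 = 0.
  - by rewrite divff ?mul1r 1?mulrC //; case: ifP => _ //; exact: oner_neq0.
  - by rewrite mulrCA [_.2 * _]mulrC E0 mulr0.
  move: E (crd_neq0 (sval x) three i) (crd_neq0 (sval x) three j); rewrite /nz.
  case: (crd _ three i) (crd _ three j) (crd _ i j) => [u1 u2] [v1 v2] [w1 w2] /=.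
  have [->|w10] := eqVneq w1 0; first by right; rewrite mul0r.
  have [->|w20] := eqVneq w2 0; first by right; rewrite mulr0.
  move=> /(congr1 (fun z => z == 0)); rewrite !mulf_eq0 (negPf w10) (negPf w20) !orbF.
  rewrite !xpair_eqE => E nzu nzv; left; move: E nzu nzv.
  by case: (u1 == 0); case: (u2 == 0); case: (v1 == 0); case: (v2 == 0).
move=> k; have := tE k; rewrite (gx t tx) /= ffunE /nz.
by case: ifP => [/andP[]//|_ E]; rewrite E eqxx in a1.
Qed.

Lemma general_orbit t : general act (act t o).
Proof.
move=> s; rewrite -act_mul => /(can_inj torus_mapK).
move=> E; apply: subspace_eq; apply/ffunP => a; rewrite [RHS]ffunE.
have /(congr1 (fun r : TT => (sval r : {ffun _}) a)) := E; rewrite /= ffunE.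
have t0 : (sval t : {ffun _}) a != 0 by apply: (svalP t).
by rewrite -[X in _ = X]mul1r => /(mulIf t0).
Qed.

(** A general point is nondegenerate, hence in the orbit of [o], and orbits of a group that meet are
    equal. *)
Lemma principal_orbit_unique :
  unique (principal_orbit act) (orbit act o).
Proof.
split; first by exists o => //; have := @general_orbit (torus_one _); rewrite act_one.
move=> _ [x gx ->].
have [t _ <-] := (range_torus x).2 (general_nondegenerate gx).
apply/seteqP; split=> _ [s _ <-].
  by have [r <-] := torus_div s t; exists r => //; rewrite act_mul.
by exists (torus_mul s t) => //; rewrite act_mul.
Qed.

Lemma Fopen_orbit : @Fopen K n `<=` orbit act o.
Proof.
move=> x Fx; apply/range_torus => k.
have i3 : (3 <= three)%N by rewrite val_three.
have [p pE] := pair_intro i3 (three_lt_elt k).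
have := crd_pair (sval x) p; rewrite pE /= => ->; have [N1 N2 _] := Fx p.
split; apply/eqP => E.
  by apply: N2; apply/eq_hpt; rewrite ?xpair_eqE ?oner_eq0 ?andbF // E mul0r mulr0.
by apply: N1; apply/eq_hpt; rewrite ?xpair_eqE ?oner_eq0 // E mul0r mulr0.
Qed.

End TorusAction.

(** * Cross ratios *)

Section Moduli.
Variables (K : closedFieldType) (n : nat).
Local Notation conf := (configurations K n).
Local Notation FF := (FbarS K n).
Local Notation FO := (subspace (@Fopen K n)).
Implicit Types (v w : P1 K) (M N : 'M[K]_2).

(** The determinant of the chosen homogeneous coordinates, zero exactly when the two points
    coincide. *)
Definition cross v w : K := (hc v).1 * (hc w).2 - (hc v).2 * (hc w).1.

Lemma cross_neq0 v w : v <> w -> cross v w != 0.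
Proof. by move=> vw; rewrite subr_eq0; apply/eqP => /hc_eq. Qed.

Lemma det_mx22 M : \det M = M 0 0 * M 1 1 - M 0 1 * M 1 0.
Proof.
rewrite (expand_det_row _ 0) !big_ord_recl big_ord0 addr0 /cofactor !det_mx11 !mxE.
have -> : lift ord0 ord0 = 1 :> 'I_2 by apply: val_inj.
have -> : lift 1 0 = 0 :> 'I_2 by apply: val_inj.
by rewrite /= expr0 expr1 mul1r mulN1r mulrN.
Qed.

Lemma cross_pluecker v w u t :
  cross w t * cross v u - cross v t * cross w u = cross v w * cross u t.
Proof. by rewrite /cross; ring. Qed.

Lemma mulmx22 M N i k : (M *m N) i k = M i 0 * N 0 k + M i 1 * N 1 k.
Proof.
rewrite mxE !big_ord_recl big_ord0 addr0.
by have -> : lift ord0 ord0 = 1 :> 'I_2 by apply: val_inj.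
Qed.

Lemma moebius_neq0 M v : M \in unitmx ->
  (M 0 0 * (hc v).1 + M 0 1 * (hc v).2, M 1 0 * (hc v).1 + M 1 1 * (hc v).2)
    != (0, 0).
Proof.
rewrite unitmxE unitfE det_mx22 => detM; apply/eqP => -[E0 E1].
have := hc_pair_neq0 v; rewrite xpair_eqE negb_and => /orP[] /eqP; apply.
  apply: (mulfI detM); rewrite mulr0.
  transitivity (M 1 1 * (M 0 0 * (hc v).1 + M 0 1 * (hc v).2)
    - M 0 1 * (M 1 0 * (hc v).1 + M 1 1 * (hc v).2)); first by ring.
  by rewrite E0 E1; ring.
apply: (mulfI detM); rewrite mulr0.
transitivity (M 0 0 * (M 1 0 * (hc v).1 + M 1 1 * (hc v).2)
  - M 1 0 * (M 0 0 * (hc v).1 + M 0 1 * (hc v).2)); first by ring.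
by rewrite E0 E1; ring.
Qed.

Lemma moebiusM M N v : M \in unitmx -> N \in unitmx ->
  moebius M (moebius N v) = moebius (M *m N) v.
Proof.
move=> uM uN; have uMN : M *m N \in unitmx by rewrite unitmx_mul uM.
apply/hpt_eq; [exact: moebius_neq0|exact: moebius_neq0|].
have [l l0 ->] := hc_hpt (moebius_neq0 v uN).
by rewrite !mulmx22 /=; ring.
Qed.

Lemma moebius1 v : moebius 1%:M v = v.
Proof.
by rewrite /moebius !mxE /= !mul1r !mul0r addr0 add0r hpt_hc.
Qed.

Lemma PGL2_equiv_refl (z : conf) : PGL2_equiv z z.
Proof. by exists 1%:M => [|k]; [exact: unitmx1|rewrite moebius1]. Qed.

Lemma PGL2_equiv_sym (z w : conf) : PGL2_equiv z w -> PGL2_equiv w z.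
Proof.
move=> [M uM wE]; exists (invmx M) => [|k]; first by rewrite unitmx_inv.
by rewrite wE moebiusM ?unitmx_inv // mulVmx // moebius1.
Qed.

Lemma PGL2_equiv_trans (z w u : conf) :
  PGL2_equiv z w -> PGL2_equiv w u -> PGL2_equiv z u.
Proof.
move=> [M uM wE] [N uN uE]; exists (N *m M) => [|k].
  by rewrite unitmx_mul uN.
by rewrite uE wE moebiusM.
Qed.

Lemma PGL2_class_eq (z w : conf) : PGL2_equiv z w ->
  class_of (@PGL2_equiv K n) z = class_of (@PGL2_equiv K n) w.
Proof.
move=> zw; apply: eq_exist; apply/seteqP; split=> u.
  exact: PGL2_equiv_trans (PGL2_equiv_sym zw).
exact: PGL2_equiv_trans zw.
Qed.


Hypothesis n_ge4 : (4 <= n)%N.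

(* The points z_1, ..., z_n of a configuration z are numbered from 0: the     *)
(* point z_i is z (label i).                                                  *)
Definition label (i : nat) : 'I_n := insubd (Ordinal (ltnW (ltnW (ltnW n_ge4)))) i.-1.

Lemma val_label i : (0 < i <= n)%N -> label i = i.-1 :> nat.
Proof. by move=> /andP[i0 i_le]; rewrite val_insubd prednK // i_le. Qed.

Lemma label_range (i : 'I_n.+1) : (3 <= i)%N -> (0 < i <= n)%N.
Proof. by move=> i3; rewrite (leq_trans _ i3) // -ltnS ltn_ord. Qed.

Lemma label_eq i j : (0 < i <= n)%N -> (0 < j <= n)%N -> i != j -> label i != label j.
Proof.
move=> i_le j_le; apply: contraNneq => E.
have := congr1 val E; rewrite /= !val_label //.
by move: i_le j_le => /andP[i0 _] /andP[j0 _]; rewrite -{2}(prednK i0) -{2}(prednK j0) => ->.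
Qed.

(** Only a numerator: the cross ratio is cross_ratio z i j / cross_ratio z j i, which becomes z_j /
    z_i when z_1 = 0 and z_2 = infinity. *)
Definition cross_ratio (z : 'I_n -> P1 K) (i j : 'I_n.+1) : K :=
  cross (z (label j)) (z (label 1%N)) * cross (z (label i)) (z (label 2%N)).

Lemma cross_label_neq0 (z : conf) i j : (0 < i <= n)%N -> (0 < j <= n)%N ->
  i != j -> cross ((sval z : {ffun _}) (label i)) ((sval z : {ffun _}) (label j)) != 0.
Proof.
move=> i_le j_le ij; apply: cross_neq0 => /(svalP z) E.
by have := label_eq i_le j_le ij; rewrite E eqxx.
Qed.

Lemma cross_ratio_neq0 (z : conf) (i j : 'I_n.+1) : (3 <= i)%N -> (3 <= j)%N ->
  cross_ratio (sval z : {ffun _}) i j != 0.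
Proof.
move=> i3 j3; have n1 : (0 < 1 <= n)%N by rewrite (leq_trans _ n_ge4).
have n2 : (0 < 2 <= n)%N by rewrite (leq_trans _ n_ge4).
rewrite mulf_neq0 // cross_label_neq0 ?label_range // neq_ltn orbC.
  by rewrite (leq_trans _ j3).
by rewrite i3.
Qed.

Lemma cross_ratio_cocycle (z : conf) : skew_cocycle (cross_ratio (sval z : {ffun _})).
Proof.
split=> [i j /andP[i3 ij]|i j k _ _]; last by rewrite /cross_ratio; ring.
by rewrite xpair_eqE negb_and cross_ratio_neq0 // (leq_trans i3) // ltnW.
Qed.

Definition cross_ratio_map (z : conf) : FF := skew_Fbar (cross_ratio_cocycle z).

Lemma cross_ratio_Fopen (z : conf) : @Fopen K n (cross_ratio_map z).
Proof.
move=> p; have /andP[i3 ij] := valP p; have j3 := leq_trans i3 (ltnW ij).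
have [g0 _] := cross_ratio_cocycle z.
have g1 := cross_ratio_neq0 z i3 j3; have g2 := cross_ratio_neq0 z j3 i3.
have nz : (cross_ratio (sval z : {ffun _}) (val p).1 (val p).2,
  cross_ratio (sval z : {ffun _}) (val p).2 (val p).1) != (0, 0) :> K * K.
  by rewrite xpair_eqE negb_and g1.
rewrite /= /skew_pt ffunE; split=> /hpt_eq E.
- have := E nz; rewrite xpair_eqE oner_eq0 => /(_ isT) /esym/eqP.
  by rewrite mulr0 mulr1 (negPf g2).
- have := E nz; rewrite xpair_eqE oner_eq0 andbF => /(_ isT) /eqP.
  by rewrite mulr0 mulr1 (negPf g1).
have := E nz; rewrite xpair_eqE oner_eq0 => /(_ isT); rewrite !mulr1 /cross_ratio.
(* By the Pluecker relation, cross ratio 1 would force z_i = z_j or z_1 = z_2. *)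
move=> /eqP; rewrite -subr_eq0 cross_pluecker mulf_eq0.
rewrite (negPf (cross_label_neq0 z (label_range i3) (label_range j3) _)).
  by rewrite (negPf (cross_label_neq0 z _ _ _)) // ?(leq_trans _ n_ge4).
by rewrite neq_ltn ij.
Qed.

Definition cross_ratio_open (z : conf) : FO := exist _ (cross_ratio_map z) (cross_ratio_Fopen z).

Lemma configurations_sheaf : function_sheaf conf.
Proof. exact: subspace_sheaf (P1pow_sheaf _ _) _. Qed.

(** Every label occurs equally often in both products, so they scale alike. This serves for a change
    of homogeneous coordinates (l = 1) and for a Moebius transformation (l its determinant). *)
Lemma cross_ratio_scale (z : 'I_n -> P1 K) (l : K) (D : 'I_n -> 'I_n -> K)
    (m : 'I_n -> K) i j : l != 0 -> (forall k, m k != 0) ->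
  (forall k h, cross (z k) (z h) = l * m k * m h * D k h) ->
  exists2 u : K, u != 0 &
    cross_ratio z i j = u * (D (label j) (label 1%N) * D (label i) (label 2%N)) /\
    cross_ratio z j i = u * (D (label i) (label 1%N) * D (label j) (label 2%N)).
Proof.
move=> l0 m0 E.
exists (l ^+ 2 * m (label i) * m (label j) * m (label 1%N) * m (label 2%N)).
  by rewrite !mulf_neq0 ?expf_neq0.
by rewrite /cross_ratio !E; split; ring.
Qed.

Lemma cross_ratio_open_morphism : morphism cross_ratio_open.
Proof.
have shC := configurations_sheaf; have shF := @FbarS_sheaf K n.
apply: morphism_subspace => //; apply: morphism_subspace => //.
apply: morphism_P1pow => // p z.
have /choice[S SE] : forall k : 'I_n, exists s : set conf * ((conf -> K) * (conf -> K)),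
    [/\ opn s.1, s.1 z, reg s.1 s.2.1, reg s.1 s.2.2 &
     forall y, s.1 y -> (s.2.1 y, s.2.2 y) != (0, 0) /\
       (sval y : {ffun 'I_n -> P1 K}) k = hpt (s.2.1 y) (s.2.2 y)].
  move=> k; have [U [a [a' H]]] := P1_regular_morphism k
    (@morphism_sval _ (P1pow K 'I_n) [set z : P1pow K 'I_n | injective (z : {ffun _})]) z.
  by exists (U, (a, a')).
have [|U [oU Uz UE]] := @opn_bigI _ _ shC _ (fun k => (S k).1) z.
  by move=> k; have [] := SE k.
pose D y k h := (S k).2.1 y * (S h).2.2 y - (S k).2.2 y * (S h).2.1 y.
have rD k h : reg U (fun y => D y k h).
  have [ok _ rk rk' _] := SE k; have [oh _ rh rh' _] := SE h.
  apply: (regD shC); [|apply: (regN shC)]; apply: (regM shC).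
  - exact: (reg_sub shC ok rk).
  - exact: (reg_sub shC oh rh').
  - exact: (reg_sub shC ok rk').
  - exact: (reg_sub shC oh rh).
exists U, (fun y => D y (label (val p).2) (label 1%N) * D y (label (val p).1) (label 2%N)),
  (fun y => D y (label (val p).1) (label 1%N) * D y (label (val p).2) (label 2%N)).
split=> //; [exact: (regM shC)|exact: (regM shC)|move=> y Uy].
have /choice[m mE] : forall k : 'I_n, exists m : K, m != 0 /\
    hc ((sval y : {ffun _}) k) = (m * (S k).2.1 y, m * (S k).2.2 y).
  move=> k; have [_ _ _ _ E] := SE k.
  by have [/hc_hpt[m m0 mE] ->] := E y (UE k y Uy); exists m.
have [||k h|u u0 [E1 E2]] := @cross_ratio_scale (sval y : {ffun _}) 1 (D y) m
  (val p).1 (val p).2.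
- exact: oner_neq0.
- by move=> k; have [] := mE k.
- by rewrite /cross (mE k).2 (mE h).2 /D /=; ring.
have [+ _] := cross_ratio_cocycle y; move=> /(_ _ _ (valP p)) nz.
have nz' : (D y (label (val p).2) (label 1%N) * D y (label (val p).1) (label 2%N),
  D y (label (val p).1) (label 1%N) * D y (label (val p).2) (label 2%N)) != (0, 0).
  move: nz; rewrite E1 E2 !xpair_eqE !(mulf_eq0 u) (negPf u0) //.
split=> //; rewrite /= /skew_pt ffunE; apply/hpt_eq => //.
by rewrite E1 E2; ring.
Qed.

Lemma cross_ratio_invariant (z w : conf) : PGL2_equiv z w ->
  cross_ratio_open z = cross_ratio_open w.
Proof.
move=> [M uM wE]; apply: subspace_eq; apply: subspace_eq; apply/ffunP => p.
rewrite /= /skew_pt !ffunE.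
have /choice[m mE] : forall k : 'I_n, exists m : K, m != 0 /\
    hc ((sval w : {ffun _}) k) =
    (m * (M 0 0 * (hc ((sval z : {ffun _}) k)).1 + M 0 1 * (hc ((sval z : {ffun _}) k)).2),
     m * (M 1 0 * (hc ((sval z : {ffun _}) k)).1 + M 1 1 * (hc ((sval z : {ffun _}) k)).2)).
  move=> k; rewrite wE.
  by have [m m0 E] := hc_hpt (moebius_neq0 ((sval z : {ffun _}) k) uM); exists m.
have detM : \det M != 0 by rewrite -unitfE -unitmxE.
have [||k h|u u0 [E1 E2]] := @cross_ratio_scale (sval w : {ffun _}) (\det M)
  (fun k h => cross ((sval z : {ffun _}) k) ((sval z : {ffun _}) h)) m (val p).1 (val p).2.
- exact: detM.
- by move=> k; have [] := mE k.
- by rewrite /cross (mE k).2 (mE h).2 det_mx22 /=; ring.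
have [+ _] := cross_ratio_cocycle z; move=> /(_ _ _ (valP p)) nz.
have [+ _] := cross_ratio_cocycle w; move=> /(_ _ _ (valP p)) nz'.
by apply/hpt_eq => //; rewrite E1 E2 /cross_ratio; ring.
Qed.

(* The configuration (0, infinity, 1, t_1, ..., t_(n-3)). *)
Definition normal_form (x : FF) (k : 'I_n) : P1 K :=
  if k == 0%N :> nat then hpt 0 1
  else if k == 1%N :> nat then hpt 1 0
  else hpt (crd (sval x) (three n) (inord k.+1)).1
           (crd (sval x) (three n) (inord k.+1)).2.

Lemma normal_form_label1 x : normal_form x (label 1%N) = hpt 0 1.
Proof. by rewrite /normal_form val_label //=; lia. Qed.

Lemma normal_form_label2 x : normal_form x (label 2%N) = hpt 1 0.
Proof. by rewrite /normal_form val_label //=; lia. Qed.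

Lemma normal_form_label x (i : 'I_n.+1) : (3 <= i)%N ->
  normal_form x (label i) =
  hpt (crd (sval x) (three n) i).1 (crd (sval x) (three n) i).2.
Proof.
move=> i3; have i_le : (0 < i <= n)%N by have := ltn_ord i; lia.
rewrite /normal_form val_label //.
have /negPf-> : i.-1 != 0%N by lia.
have /negPf-> : i.-1 != 1%N by lia.
by rewrite prednK ?inord_val //; lia.
Qed.

Lemma label_surj (k : 'I_n) :
  [\/ k = label 1%N, k = label 2%N | exists2 i : 'I_n.+1, (3 <= i)%N & k = label i].
Proof.
have kn := ltn_ord k; case: (ltngtP k 1%N) => k1.
- by apply: Or31; apply: val_inj; rewrite /= val_label; lia.
- apply: Or33; exists (inord k.+1); rewrite inordK //.
  by apply: val_inj; rewrite /= val_label //; lia.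
- by apply: Or32; apply: val_inj; rewrite /= val_label //=; lia.
Qed.

Lemma Fopen_crd_neq0 (x : FF) (i : 'I_n.+1) : Fopen x -> (3 <= i)%N ->
  (crd (sval x) (three n) i).1 != 0 /\ (crd (sval x) (three n) i).2 != 0.
Proof.
move=> Fx /(elt_surj n_ge4)[->|[k ->]]; first by rewrite crd_id /= oner_neq0.
exact: (range_torus n_ge4 x).1 (Fopen_orbit n_ge4 Fx) k.
Qed.

Lemma crd_three_cocycle (x : FF) (i j : 'I_n.+1) : (3 <= i)%N -> (3 <= j)%N ->
  (crd (sval x) (three n) i).1 * (crd (sval x) (three n) j).2 * (crd (sval x) i j).1 =
  (crd (sval x) (three n) i).2 * (crd (sval x) (three n) j).1 * (crd (sval x) i j).2.
Proof.
by move=> i3 j3; apply: crd_cocycle => //; [exact: (svalP x)|rewrite val_three].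
Qed.

(** A coincidence of two of the points would force some x_3i to be 0 or infinity, or some x_ij to be
    1. *)
Lemma normal_form_inj (x : FF) : Fopen x -> injective (normal_form x).
Proof.
move=> Fx.
have nz01 : ((0, 1) : K * K) != (0, 0) by rewrite xpair_eqE oner_eq0 andbF.
have nz10 : ((1, 0) : K * K) != (0, 0) by rewrite xpair_eqE oner_eq0.
have H01 : hpt 0 1 <> hpt 1 0 :> P1 K.
  by move=> /(hpt_eq nz01 nz10)/eqP; rewrite mulr0 mulr1 eq_sym oner_eq0.
have H0 (i : 'I_n.+1) : (3 <= i)%N -> normal_form x (label i) <> hpt 0 1.
  move=> i3; have [u0 _] := Fopen_crd_neq0 Fx i3; rewrite normal_form_label //.
  move=> /(hpt_eq (crd_neq0 _ _ _) nz01)/eqP.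
  by rewrite mulr1 mulr0 (negPf u0).
have H1 (i : 'I_n.+1) : (3 <= i)%N -> normal_form x (label i) <> hpt 1 0.
  move=> i3; have [_ u0] := Fopen_crd_neq0 Fx i3; rewrite normal_form_label //.
  move=> /(hpt_eq (crd_neq0 _ _ _) nz10)/eqP.
  by rewrite mulr1 mulr0 eq_sym (negPf u0).
have Hij (i j : 'I_n.+1) : (3 <= i)%N -> (i < j)%N ->
    normal_form x (label i) <> normal_form x (label j).
  move=> i3 ij; have j3 := leq_trans i3 (ltnW ij).
  rewrite !normal_form_label // => /(hpt_eq (crd_neq0 _ _ _) (crd_neq0 _ _ _)) E.
  have [i1 i2] := Fopen_crd_neq0 Fx i3; have [j1 j2] := Fopen_crd_neq0 Fx j3.
  have [p pE] := pair_intro i3 ij; have := crd_three_cocycle x i3 j3.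
  rewrite -E => /(mulfI (mulf_neq0 i1 j2)).
  have := crd_pair (sval x) p; rewrite pE /= => -> E'.
  have [_ _] := Fx p; apply; apply/eq_hpt; last by rewrite !mulr1.
  by rewrite xpair_eqE oner_eq0.
move=> k l; case: (label_surj k) => [->|->|[i i3 ->]];
  case: (label_surj l) => [->|->|[j j3 ->]] //;
  rewrite ?normal_form_label1 ?normal_form_label2.
- by move/H01.
- by move/esym/H0.
- by move/esym/H01.
- by move/esym/H1.
- by move/H0.
- by move/H1.
- case: (ltngtP i j) => [ij E|ji E|/val_inj-> //].
    by case: (Hij _ _ i3 ij E).
  by case: (Hij _ _ j3 ji (esym E)).
Qed.

Lemma normal_form_conf_subproof (x : FO) :
  injective ([ffun k => normal_form (sval x) k] : {ffun 'I_n -> P1 K}).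
Proof. by move=> k l; rewrite !ffunE; apply: normal_form_inj; apply: (svalP x). Qed.

Definition normal_form_conf (x : FO) : conf :=
  exist _ ([ffun k => normal_form (sval x) k] : {ffun 'I_n -> P1 K})
    (@normal_form_conf_subproof x).

Lemma P1_regular_cst (X : space K) (a b : K) : function_sheaf X ->
  (a, b) != (0, 0) -> P1_regular (fun _ : X => hpt a b).
Proof.
move=> shX ab x; exists setT, (fun=> a), (fun=> b).
by split=> //; [exact: opn_setT|exact: reg_cst|exact: reg_cst].
Qed.

Lemma P1_regular_ext (X : space K) (f g : X -> P1 K) :
  f =1 g -> P1_regular f -> P1_regular g.
Proof. by move=> /funext->. Qed.

Lemma normal_form_conf_morphism : morphism normal_form_conf.
Proof.
have shF := @FbarS_sheaf K n; have shFO : function_sheaf FO := subspace_sheaf shF _.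
have mF : morphism (fun x : FO => sval (sval x)).
  exact: (morphism_comp (@morphism_sval _ FF (@Fopen K n))
    (@morphism_sval _ (P1pow K (pairs n)) (@Fbar K n))).
apply: morphism_subspace => //; apply: morphism_P1pow => // k.
apply: (@P1_regular_ext _ (fun x : FO => normal_form (sval x) k)).
  by move=> x; rewrite /= ffunE.
have nz a b : (a != 0) || (b != 0) -> (a, b) != (0, 0) :> K * K.
  by rewrite xpair_eqE negb_and.
case: (label_surj k) => [->|->|[i i3 ->]].
- apply: P1_regular_ext => [x|]; first by rewrite normal_form_label1.
  by apply: P1_regular_cst => //; apply: nz; rewrite oner_neq0 orbT.
- apply: P1_regular_ext => [x|]; first by rewrite normal_form_label2.
  by apply: P1_regular_cst => //; apply: nz; rewrite oner_neq0.
apply: (@P1_regular_ext _ (fun x : FO => hpt (crd (sval (sval x)) (three n) i).1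
  (crd (sval (sval x)) (three n) i).2)).
  by move=> x; rewrite normal_form_label.
case: (elt_surj n_ge4 i3) => [->|[l ->]].
  apply: (@P1_regular_ext _ (fun=> hpt 1 1)) => [x|]; first by rewrite crd_id.
  by apply: P1_regular_cst => //; apply: nz; rewrite oner_neq0.
have th3 : (3 <= three n)%N by rewrite val_three.
have [p pE] := pair_intro th3 (three_lt_elt n_ge4 l).
apply: P1_regular_ext (P1_regular_morphism p mF) => x /=.
by have := crd_pair (sval (sval x)) p; rewrite pE /= => ->; rewrite hpt_hc.
Qed.

Lemma normal_formK : cancel normal_form_conf cross_ratio_open.
Proof.
move=> x; apply: subspace_eq; apply: subspace_eq; apply/ffunP => p.
have [+ _] := cross_ratio_cocycle (normal_form_conf x).
move=> /(_ _ _ (valP p)) nz.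
rewrite [LHS]ffunE; apply/esym/eq_hpt => //.
have /andP[i3 ij] := valP p; have j3 := leq_trans i3 (ltnW ij).
have := crd_three_cocycle (sval x) i3 j3; rewrite crd_pair.
have nz01 : ((0, 1) : K * K) != (0, 0) by rewrite xpair_eqE oner_eq0 andbF.
have nz10 : ((1, 0) : K * K) != (0, 0) by rewrite xpair_eqE oner_eq0.
rewrite /cross_ratio /cross /= !ffunE normal_form_label1 normal_form_label2.
rewrite !normal_form_label //.
have [l l0 ->] := hc_hpt nz01; have [m m0 ->] := hc_hpt nz10.
have [li li0 ->] := hc_hpt (crd_neq0 (sval (sval x)) (three n) (val p).1).
have [lj lj0 ->] := hc_hpt (crd_neq0 (sval (sval x)) (three n) (val p).2).
move: (crd _ _ (val p).1) (crd _ _ (val p).2) (hc _) => [u1 u2] [v1 v2] [w1 w2] /= E.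
transitivity (- (li * lj * l * m) * (u1 * v2 * w1)); first by ring.
by rewrite E; ring.
Qed.

Lemma cross_ratioK (z : conf) : PGL2_equiv z (normal_form_conf (cross_ratio_open z)).
Proof.
pose w k := (sval z : {ffun 'I_n -> P1 K}) (label k).
have n1 : (0 < 1 <= n)%N by rewrite (leq_trans _ n_ge4).
have n2 : (0 < 2 <= n)%N by rewrite (leq_trans _ n_ge4).
have n3 : (0 < 3 <= n)%N by rewrite (leq_trans _ n_ge4).
have a0 : cross (w 3%N) (w 2%N) != 0 by apply: cross_label_neq0.
have b0 : cross (w 3%N) (w 1%N) != 0 by apply: cross_label_neq0.
have c0 : cross (w 1%N) (w 2%N) != 0 by apply: cross_label_neq0.
have c0' : cross (w 2%N) (w 1%N) != 0 by apply: cross_label_neq0.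
pose a := cross (w 3%N) (w 2%N); pose b := cross (w 3%N) (w 1%N).
(* The transformation taking z_1, z_2, z_3 to 0, infinity, 1: it sends v to (a * cross v z_1 : b *
   cross v z_2), and the factors a, b make both coordinates of the image of z_3 equal to a b. *)
pose M : 'M[K]_2 := \matrix_(i, j)
  (if i == 0 then (if j == 0 then a * (hc (w 1%N)).2 else - a * (hc (w 1%N)).1)
   else (if j == 0 then b * (hc (w 2%N)).2 else - b * (hc (w 2%N)).1)).
have ME v : moebius M v = hpt (a * cross v (w 1%N)) (b * cross v (w 2%N)).
  by rewrite /moebius !mxE /= /cross; congr hpt; ring.
have uM : M \in unitmx.
  rewrite unitmxE unitfE det_mx22 !mxE /=.
  have -> : a * (hc (w 1%N)).2 * (- b * (hc (w 2%N)).1) - - a * (hc (w 1%N)).1 *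
    (b * (hc (w 2%N)).2) = a * b * cross (w 1%N) (w 2%N) by rewrite /cross; ring.
  by rewrite !mulf_neq0.
have cc v : cross v v = 0 by rewrite /cross mulrC subrr.
have nz x y : (x != 0) || (y != 0) -> (x, y) != (0, 0) :> K * K.
  by rewrite xpair_eqE negb_and.
exists M => // k; rewrite /= ffunE ME.
case: (label_surj k) => [->|->|[i i3 ->]].
- rewrite normal_form_label1 -/(w 1%N) cc mulr0; apply/hpt_eq.
  + by apply: nz; rewrite oner_neq0 orbT.
  + by apply: nz; rewrite [b * _ != 0]mulf_neq0 ?orbT.
  + by rewrite mul0r mulr0.
- rewrite normal_form_label2 -/(w 2%N) cc mulr0; apply/hpt_eq.
  + by apply: nz; rewrite oner_neq0.
  + by apply: nz; rewrite [a * _ != 0]mulf_neq0.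
  + by rewrite mul0r mulr0.
rewrite normal_form_label // -/(w i).
have w1 : cross (w i) (w 1%N) != 0.
  apply: cross_label_neq0 => //; first exact: label_range.
  by rewrite neq_ltn orbC (leq_trans _ i3).
apply/hpt_eq; first exact: crd_neq0.
  by apply: nz; rewrite [a * _ != 0]mulf_neq0.
case: (elt_surj n_ge4 i3) => [iE|[l iE]].
  rewrite iE crd_id /w (val_three n_ge4) /= !mul1r -/(w 3%N) -/(w 1%N) -/(w 2%N) mulrC //.
have th3 : (3 <= three n)%N by rewrite val_three.
have [|u u0 E] := crd_skew_pt (cross_ratio_cocycle z) th3 i3.
  by rewrite iE neq_ltn three_lt_elt.
rewrite [crd _ _ _]E /= /cross_ratio (val_three n_ge4) -/(w i) -/(w 1%N) -/(w 2%N) -/(w 3%N) -/a -/b.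
by ring.
Qed.

Lemma Fopen_isomorphic_M0 : isomorphic FO (M0 K n).
Proof.
(* A chosen configuration in each class; by invariance the cross ratios do not depend on it, and so
   the composite with [class_of] is the morphism [cross_ratio_open]. *)
pose rep (C : M0 K n) : conf := sval (cid (svalP C)).
have repE (C : M0 K n) : C = class_of (@PGL2_equiv K n) (rep C).
  by case: C => C CE; apply: eq_exist; rewrite /rep /=; case: cid.
have repP (z : conf) : PGL2_equiv (rep (class_of (@PGL2_equiv K n) z)) z.
  have := congr1 (fun C : M0 K n => sval C z) (repE (class_of (@PGL2_equiv K n) z)).
  by move=> /= <-; apply: PGL2_equiv_refl.
exists (class_of (@PGL2_equiv K n) \o normal_form_conf); split.
  exact: (morphism_comp normal_form_conf_morphism (@morphism_class_of _ conf _)).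
have gE z : cross_ratio_open (rep (class_of (@PGL2_equiv K n) z)) =
    cross_ratio_open z by apply/cross_ratio_invariant/repP.
exists (cross_ratio_open \o rep); split.
- apply: morphism_quotient.
  rewrite (_ : _ \o _ = cross_ratio_open); first exact: cross_ratio_open_morphism.
  by apply/funext => z; apply: gE.
- by move=> x /=; rewrite gE normal_formK.
- by move=> C /=; rewrite [RHS]repE; apply/esym/PGL2_class_eq/cross_ratioK.
Qed.

End Moduli.

Theorem proposition11 (R : realType) (n : nat) (hn : (4 <= n)%N) :
  smooth_toric_variety (S := @Fbar R[i] n) (@act_Fbar R[i] n) /\
  isomorphic (subspace (@Fopen R[i] n)) (M0 R[i] n) /\
  exists O : set (FbarS R[i] n),
    unique (principal_orbit (@act_Fbar R[i] n)) O /\ @Fopen R[i] n `<=` O.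
Proof.
split; first exact: Fbar_smooth_toric.
split; first exact: Fopen_isomorphic_M0.
exists (orbit (@act_Fbar R[i] n) (base_point R[i] n)).
by split; [exact: principal_orbit_unique|exact: Fopen_orbit].
Qed.
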